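(* Let $T>0$, $\sigma>0$ and let $K>0$. Then there exists a constant $C_K>0$ depending at most on $K$ such that $$\mathbb{E}|J_n-n_\theta|^K\le C_K\,n_\theta^{K/2}\qquad\text{for all }(n,t_0)\in2\mathbb{N}\times[0,T).$$
   Context: $(W_t)_{t\ge0}$ is a standard Brownian motion and $X_t:=\sigma W_t$. $2\mathbb{N}$ denotes the positive even integers. For $n\in2\mathbb{N}$ and $t_0\in[0,T)$ put $$h=\sigma\sqrt{T/n},\qquad n_\theta=2\Big\lceil\frac{T-t_0}{2T/n}\Big\rceil,\qquad\theta_n=\frac{n_\theta T}{n}.$$ The stopping times are $\tau_0=0$, $\tau_k=\inf\{t\ge\tau_{k-1}:|X_t-X_{\tau_{k-1}}|=h\}$, $k\ge1$, and $J_n:=\inf\{2m\in2\mathbb{N}:\tau_{2m}>\theta_n\}$. *)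

(* Defs.v *)
From HB Require Import structures.
From mathcomp Require Import all_boot all_order all_algebra.
From mathcomp Require Import all_classical all_reals all_analysis.

Set Implicit Arguments.
Unset Strict Implicit.
Unset Printing Implicit Defensive.

Import Order.TTheory GRing.Theory Num.Theory.
Import numFieldNormedType.Exports.

Local Open Scope classical_set_scope.
Local Open Scope ring_scope.

(* The product rule for the whole family implies the one for every subfamily:
   take B i = setT outside of the subfamily. *)
Definition mutually_independent (R : realType) (d : measure_display)
    (Omega : measurableType d) (P : probability Omega R) (n : nat)
    (Y : 'I_n -> Omega -> R) : Prop :=
  forall B : 'I_n -> set R, (forall i, measurable (B i)) ->
    P (\bigcap_(i in [set: 'I_n]) (Y i @^-1` B i)) =
    (\prod_(i < n) P (Y i @^-1` B i))%E.

(* The process is indexed by R, but only its values at times t >= 0 are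
   constrained.  The second argument of normal_prob is the standard deviation.
   Increments over empty intervals vanish, so independence may as well be asked
   along nondecreasing times. *)
Record brownian_motion (R : realType) (d : measure_display)
    (Omega : measurableType d) (P : probability Omega R)
    (W : R -> Omega -> R) : Prop := BrownianMotion {
  bm_measurable : forall t : R, 0 <= t -> measurable_fun [set: Omega] (W t) ;
  bm_start : {ae P, forall w, W 0 w = 0} ;
  bm_independent_increments : forall (n : nat) (t : nat -> R),
    0 <= t 0%N -> nondecreasing_seq t ->
    mutually_independent P (fun i : 'I_n => W (t i.+1) \- W (t i)) ;
  bm_gaussian_increments : forall s t : R, 0 <= s -> s < t ->
    forall B : set R, measurable B ->
    pushforward P (W t \- W s) B = normal_prob 0 (Num.sqrt (t - s)) B ;
  bm_continuous : {ae P, forall w,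
    {within `[0, +oo[, continuous (fun t : R => W t w)}}
}.

Definition positive_even : set nat := [set n | (0 < n)%N /\ ~~ odd n].

Definition step (R : realType) (sigma T : R) (n : nat) : R :=
  sigma * Num.sqrt (T / n%:R).

Definition ntheta (R : realType) (T : R) (n : nat) (t0 : R) : int :=
  2 * Num.ceil ((T - t0) / (2 * T / n%:R)).

Definition theta (R : realType) (T : R) (n : nat) (t0 : R) : R :=
  (ntheta T n t0)%:~R * T / n%:R.

(* Stopping times are extended-real valued, with inf(empty set) = +oo; in
   particular, once tau k = +oo, all later ones are +oo as well, and the junk
   value fine +oo is never used. *)
Fixpoint tau (R : realType) (Omega : Type) (X : R -> Omega -> R) (h : R)
    (k : nat) (w : Omega) : \bar R :=
  if k is k'.+1 then
    ereal_inf [set t%:E | t in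
      [set t : R | (tau X h k' w <= t%:E)%E /\
                   `|X t w - X (fine (tau X h k' w)) w| = h]]
  else 0%E.

Definition first_even_after (R : realType) (Omega : Type)
    (X : R -> Omega -> R) (h theta : R) (w : Omega) : \bar R :=
  ereal_inf [set (j%:R)%:E | j in
    [set j : nat | positive_even j /\ (theta%:E < tau X h j w)%E]].

(* Main.v *)
Require Import Defs.
From HB Require Import structures.
From mathcomp Require Import all_boot all_order all_algebra.
From mathcomp Require Import all_classical all_reals all_analysis.
From mathcomp Require Import measurable_realfun.
From mathcomp Require Import ring lra zify.

Import Order.TTheory GRing.Theory Num.Theory.
Import numFieldNormedType.Exports.

Local Open Scope classical_set_scope.
Local Open Scope ring_scope.

(** Put [delta := T / n], [h := sigma * sqrt delta], [N := ntheta], so that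
    [theta = N * delta].  A move of [X] by [h] takes the time [delta] on average,
    so about [N] moves are made by the time [theta], and [J] exceeds their number
    by at most 2.  The claim is that this number fluctuates on the scale
    [sqrt N], and it is enough to bound the expectation of
    [expR (|J - N| / (16 * sqrt N))] by an absolute constant, because
    [z `^ K <= (16 * K) `^ K * expR (z / 16)].

    Let [k] be the number of moves made by the time [t] and [y] the present
    displacement from the last stopping point, in units of [h].  Between two
    moves [y ^+ 2 - t / delta] is a martingale.  With [lam := 1 / (8 * sqrt N)],
    a factor [c] close to [1 + lam] and a factor [C] close to [1 - lam], the
    quantities [c ^+ k * (1 + lam * y ^+ 2)] and [C ^+ k * (1 - lam * y ^+ 2)]
    do not increase when a move is counted ([k] grows by one and [y] drops from
    [1] to [0]), and in between their expectations grow at most at the rates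
    [lam / delta] and [- lam / delta].  At the time [theta] this gives
    [E c ^+ k <= expR (lam * N)] and [E C ^+ k.+1 <= expR (- lam * N)].  Since
    [lam ^+ 2 * N = 1 / 64], the errors of second order in [c = 1 + lam + ...]
    and [C = 1 - lam + ...] only cost constant factors, and the two bounds
    control the upper and the lower exponential moments of [(J - N) / sqrt N]
    ([deviation_le]).

    The supermartingale property is used along a grid only, which replaces the
    strong Markov property by the independence of finitely many increments.  The
    path is sampled with the mesh [delta / m], and the sampled walk switches to a
    neighbouring lattice point as soon as its displacement reaches a radius [r].
    For a fine mesh, the radius [1 - lam] makes the sampled walk switch at least
    as often as the path moves ([tau_le_switches]), and the radius [1 + lam] at
    most as often ([switches_tau_le]).  Walks with an increment larger than [lam]
    are given the weight [0]: this bounds the overshoot at a switch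
    ([expectation_lyapunov]), and a continuous path has no such increment once
    the mesh is fine ([small_increments]).  The lemma of Fatou lets [m] tend to
    infinity; it bounds the integral of [|J - N| `^ K] from a pointwise bound,
    without any measurability of the stopping times. *)

(** * Independence of the past and integration of the next increment *)

(** The two sides are finite measures in [A], and a generating family that is
    closed under intersection determines such a measure. *)
Lemma indep_generated {R : realType} {d : measure_display}
    {Omega : measurableType d} (P : probability Omega R)
    (C : set (set Omega)) (B : set Omega) :
  C `<=` measurable -> C setT -> setI_closed C -> measurable B ->
  (forall A, C A -> P (A `&` B) = (P A * P B)%E) ->
  forall A, <<s C >> A -> P (A `&` B) = (P A * P B)%E.
Proof.
move=> Cm CT CI mB CP.
have PBfin : P B \is a fin_num by exact: fin_num_measure.
have PB0 : 0 <= fine (P B) by rewrite fine_ge0// measure_ge0.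
pose mu1 := mrestr P mB; pose mu2 := mscale (NngNum PB0) P.
move=> A sA; transitivity (mu1 A); first by [].
rewrite (_ : (P A * P B)%E = mu2 A); last first.
  by rewrite /mu2 /mscale/= fineK// muleC.
apply: (@g_sigma_algebra_measure_unique _ R _ C Cm (fun=> setT)) => //.
- by rewrite bigcup_const.
- by move=> A' CA; rewrite /= /mscale/= /mrestr CP// fineK// muleC.
- move=> _; rewrite (@le_lt_trans _ _ 1%E) ?ltry//=.
  by rewrite /mrestr setTI; exact: probability_le1.
Qed.

(** Conditioning on the past: the joint law of the point [w], seen through the
    sigma-algebra generated by [C], and of the independent variable [G] is a
    product, so the next increment can be integrated out with [w] frozen. *)
Lemma indep_fubini {R : realType} {d : measure_display}
    {Omega : measurableType d} (P : probability Omega R)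
    (C : set (set Omega)) (G : {mfun Omega >-> R})
    (Psi : g_sigma_algebraType C * R -> \bar R) :
  C `<=` measurable -> C setT -> setI_closed C ->
  (forall A B, C A -> measurable B ->
     P (A `&` G @^-1` B) = (P A * P (G @^-1` B))%E) ->
  (forall w g, 0 <= Psi (w, g))%E ->
  measurable_fun setT Psi ->
  (\int[P]_w Psi (w, G w) =
   \int[P]_w \int[distribution P G]_g Psi (w, g))%E.
Proof.
move=> Cm CT CI CP Psi0 mPsi.
have sCm : <<s C >> `<=` measurable.
  by apply: smallest_sub => //; exact: sigma_algebra_measurable.
have mid : measurable_fun setT (id : Omega -> g_sigma_algebraType C).
  by move=> _ A mA; rewrite setTI; exact: sCm.
pose I : {mfun Omega >-> g_sigma_algebraType C} :=
  HB.pack (id : Omega -> g_sigma_algebraType C)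
    (isMeasurableFun.Build _ _ _ _ _ mid).
have mj : measurable_fun setT (fun w : Omega => (w : g_sigma_algebraType C, G w)).
  exact: (@measurable_fun_pair _ _ _ _ _ _
    (id : Omega -> g_sigma_algebraType C) G mid (measurable_funPT G)).
pose J : {mfun Omega >-> (g_sigma_algebraType C * R)%type} :=
  HB.pack (fun w : Omega => (w : g_sigma_algebraType C, G w))
    (isMeasurableFun.Build _ _ _ _ _ mj).
transitivity (\int[distribution P J]_z Psi z)%E.
  by rewrite ge0_integral_distribution//; case.
transitivity (\int[distribution P I \x distribution P G]_z Psi z)%E.
  apply: eq_measure_integral => A mA _; apply/esym.
  apply: product_measure_unique => // B1 B2 mB1 mB2.
  change (P (B1 `&` G @^-1` B2) = (P B1 * P (G @^-1` B2))%E).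
  apply: (@indep_generated _ _ _ P C) => //; last by move=> A1 CA1; exact: CP.
  by rewrite -[X in measurable X]setTI; exact: measurable_funP.
rewrite fubini_tonelli1//; last by case.
rewrite ge0_integral_distribution//.
- by apply: measurable_fun_fubini_tonelli_F => //; case.
- by move=> w; exact: integral_ge0.
Qed.

(** * Walks recentred at lattice points *)

(** At most one switch per step: an increment so large that it would call for
    several ones makes the weight of the walk vanish. *)
Definition recenter {R : realType} (r z : R) : R :=
  if r <= z then z - 1 else if z <= - r then z + 1 else z.

(** Displacement of the walk with increments [g] from its present lattice
    point. *)
Fixpoint offset {R : realType} (r : R) (g : nat -> R) (i : nat) : R :=
  if i is j.+1 then recenter r (offset r g j + g j) else 0.

Fixpoint switches {R : realType} (r : R) (g : nat -> R) (i : nat) : nat :=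
  if i is j.+1 then (switches r g j + (r <= `|offset r g j + g j|)%R)%N else 0%N.

(** A walk is discarded after an increment larger than [eps], so that no walk of
    nonzero weight overshoots the switching radius by more than [eps]. *)
Fixpoint weight {R : realType} (r eps c : R) (g : nat -> R) (i : nat) : R :=
  if i is j.+1 then
    weight r eps c g j * (if `|g j| <= eps then 1 else 0) *
      (if r <= `|offset r g j + g j| then c else 1)
  else 1.

Section walk.
Context {R : realType}.
Implicit Types (r eps c z kap : R) (g : nat -> R).

Lemma recenter_small r z : `|z| < r -> recenter r z = z.
Proof. by rewrite /recenter ltr_norml => /andP[z1 z2]; rewrite leNgt z2 leNgt z1. Qed.

Lemma norm_recenter r z : r <= `|z| -> 0 < r -> `|recenter r z| = `| `|z| - 1|.
Proof.
rewrite /recenter => rz r0; have [z0|z0] := leP 0 z.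
  by move: rz; rewrite (ger0_norm z0) => ->.
move: rz; rewrite (ltr0_norm z0) => rz.
have -> : (r <= z) = false by apply/negbTE; rewrite -ltNge; lra.
have -> : z <= - r by lra.
by rewrite -[LHS]normrN opprD.
Qed.

Lemma weight_ge0 r eps c g i : 0 <= c -> 0 <= weight r eps c g i.
Proof.
move=> c0; elim: i => //= i IH; rewrite !mulr_ge0//.
all: by case: ifP.
Qed.

Lemma weightE r eps c g i : (forall j, (j < i)%N -> `|g j| <= eps) ->
  weight r eps c g i = c ^+ switches r g i.
Proof.
elim: i => //= i IH H; rewrite IH; last by move=> j ji; apply: H; exact: ltnW.
rewrite H// mulr1 exprD; congr (_ * _); by case: ifP; rewrite ?expr1 ?expr0.
Qed.

(** A switch from a displacement of modulus in [r, r + eps] leads to one of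
    modulus at most [max (1 - r) (r + eps - 1)], which is below [r] under the two
    numerical hypotheses. *)
Lemma offset_lt r eps g i : 1/2 < r -> eps < 1 ->
  (forall j, (j < i)%N -> `|g j| <= eps) -> `|offset r g i| < r.
Proof.
move=> r2 e1; elim: i => [|i IH] H /=; first by rewrite normr0; lra.
have {}IH : `|offset r g i| < r by apply: IH => j ji; apply: H; exact: ltnW.
have Hi := H i (ltnSn i).
have zr : `|offset r g i + g i| < r + eps.
  by rewrite (le_lt_trans (ler_normD _ _))// ltr_leD.
have [rz|] := leP r `|offset r g i + g i|; last first.
  by move=> h; rewrite recenter_small.
by rewrite norm_recenter//; [rewrite ltr_norml; apply/andP; split; lra|lra].
Qed.

Lemma weight_neq0 r eps c g i : weight r eps c g i != 0 ->
  forall j, (j < i)%N -> `|g j| <= eps.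
Proof.
elim: i => //= i IH; rewrite !mulf_eq0 !negb_or => /andP[/andP[w0 gi] _] j.
rewrite ltnS leq_eqVlt => /orP[/eqP ->|]; last exact: IH.
by move: gi; case: ifP => // _; rewrite eqxx.
Qed.

Lemma offset_ext r g g' i : (forall j, (j < i)%N -> g j = g' j) ->
  offset r g i = offset r g' i.
Proof.
elim: i => //= i IH H; rewrite IH; last by move=> j ji; apply: H; exact: ltnW.
by rewrite H.
Qed.

Lemma weight_ext r eps c g g' i : (forall j, (j < i)%N -> g j = g' j) ->
  weight r eps c g i = weight r eps c g' i.
Proof.
elim: i => //= i IH H; rewrite IH; last by move=> j ji; apply: H; exact: ltnW.
by rewrite H// (offset_ext r g g')// => j ji; apply: H; exact: ltnW.
Qed.

Lemma measurable_offset d (T : measurableType d) r (G : nat -> T -> R) i :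
  (forall j, (j < i)%N -> measurable_fun setT (G j)) ->
  measurable_fun setT (fun w => offset r (G ^~ w) i).
Proof.
elim: i => [|i IH] mG /=; first exact: measurable_cst.
have mz : measurable_fun setT (fun w => offset r (G ^~ w) i + G i w).
  apply: measurable_funD; last exact: mG.
  by apply: IH => j ji; apply: mG; exact: ltnW.
rewrite /recenter; apply: measurable_fun_ifT; first exact: measurable_fun_ler.
  exact: measurable_funB.
apply: measurable_fun_ifT => //; first exact: measurable_fun_ler.
exact: measurable_funD.
Qed.

Lemma measurable_weight d (T : measurableType d) r eps c (G : nat -> T -> R) i :
  (forall j, (j < i)%N -> measurable_fun setT (G j)) ->
  measurable_fun setT (fun w => weight r eps c (G ^~ w) i).
Proof.
elim: i => [|i IH] mG /=; first exact: measurable_cst.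
have mz : measurable_fun setT (fun w => offset r (G ^~ w) i + G i w).
  apply: measurable_funD; last exact: mG.
  by apply: measurable_offset => j ji; apply: mG; exact: ltnW.
apply: measurable_funM; first apply: measurable_funM.
- by apply: IH => j ji; apply: mG; exact: ltnW.
- apply: measurable_fun_ifT => //; apply: measurable_fun_ler => //.
  by apply: measurableT_comp => //; exact: mG.
- apply: measurable_fun_ifT => //; apply: measurable_fun_ler => //.
  exact: measurableT_comp.
Qed.
End walk.

(** * The quadratic supermartingale of a recentred walk *)

(** With [kap > 0] and [c > 1] this detects too many switches, with [kap < 0] and
    [c < 1] too few. *)
Definition lyapunov {R : realType} (r eps c kap : R) (g : nat -> R) (i : nat) : R :=
  weight r eps c g i * (1 + kap * offset r g i ^+ 2).

Section one_step.
Context {R : realType} (r eps c kap : R).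
Hypotheses (r_gt : 1/2 < r) (eps0 : 0 < eps) (eps1 : eps < 1) (c0 : 0 <= c).
Hypothesis switch_le : forall z, r <= z <= r + eps ->
  c * (1 + kap * (z - 1) ^+ 2) <= 1 + kap * z ^+ 2.
Hypothesis quadratic_ge0 : forall z, 0 <= z <= r + eps -> 0 <= 1 + kap * z ^+ 2.

(** The condition relating [c] and [kap] says that a switch does not increase the
    product, so switches can be ignored; only the drift of the quadratic function
    remains. *)
Lemma lyapunov_step (g : nat -> R) i :
  0 <= lyapunov r eps c kap g i.+1 <=
  weight r eps c g i * (if `|g i| <= eps then
     1 + kap * (offset r g i + g i) ^+ 2 else 0).
Proof.
rewrite /lyapunov /=.
have [->|w0] := eqVneq (weight r eps c g i) 0; first by rewrite !mul0r lexx.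
have w1 : 0 <= weight r eps c g i by exact: weight_ge0.
case: ifPn => ge; last by rewrite !(mulr0, mul0r) lexx.
have ylt := @offset_lt _ r eps g i r_gt eps1 (@weight_neq0 _ _ _ _ _ _ w0).
set z := offset r g i + g i.
have zr : `|z| <= r + eps.
  by rewrite (le_trans (ler_normD _ _))// lerD// ltW.
rewrite mulr1 -!mulrA; clearbody z.
move: (r_gt) (eps0) (eps1) => r2 e0 e1.
have r0 : 0 < r by apply: lt_trans r_gt; rewrite divr_gt0.
have z2 : z ^+ 2 = `|z| ^+ 2 by rewrite real_normK// num_real.
case: ifPn => rz.
  have -> : recenter r z ^+ 2 = (`|z| - 1) ^+ 2.
    by rewrite -[LHS]real_normK ?num_real// norm_recenter// real_normK ?num_real.
  rewrite (ler_wpM2l w1) ?z2 ?switch_le ?rz ?zr// andbT.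
  rewrite mulr_ge0// mulr_ge0//.
  rewrite -[(`|z| - 1) ^+ 2]real_normK ?num_real//; apply: quadratic_ge0.
  rewrite normr_ge0/= ler_norml; apply/andP; split; lra.
rewrite -ltNge in rz; rewrite recenter_small// mul1r lexx andbT.
by rewrite mulr_ge0// z2 quadratic_ge0// normr_ge0.
Qed.

Lemma lyapunov_ge0 (g : nat -> R) i : 0 <= lyapunov r eps c kap g i.
Proof.
case: i => [|i]; last by have /andP[] := lyapunov_step g i.
by rewrite /lyapunov/= expr0n/= mulr0 addr0 mulr1.
Qed.

Variable nu : probability R R.
Variable s : R.
Hypothesis nu1 : \int[nu]_(x in `[- eps, eps]) x = 0.
Hypothesis nu2 : \int[nu]_(x in `[- eps, eps]) x ^+ 2 = s.

(** Expanding the square, the linear term has mean zero and what is left is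
    [(1 + kap * y ^+ 2) * p + kap * s] with [p <= 1].  The discrepancy with the
    right-hand side is at least [kap ^+ 2 * y ^+ 2 * s], whatever the sign of
    [kap]. *)
Lemma integral_quadratic y : 0 <= 1 + kap * y ^+ 2 ->
  (\int[nu]_(g in `[(- eps)%R, eps]) (1 + kap * (y + g) ^+ 2)%:E <=
   ((1 + kap * s) * (1 + kap * y ^+ 2))%:E)%E.
Proof.
move=> y0; set D := [set` _].
have mD : measurable D by exact: measurable_itv.
have Dfin : (nu D < +oo)%E by rewrite (le_lt_trans (probability_le1 _ _)) ?ltry.
have ib (f : R -> R) (M : R) : measurable_fun setT f ->
    (forall x, `|x| <= eps -> `|f x| <= M) -> nu.-integrable D (EFin \o f).
  move=> mf fM; apply: measurable_bounded_integrable => //.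
    exact: (@measurable_funS _ _ _ _ setT).
  exists M; split; first exact: num_real.
  move=> x Mx t; rewrite /D/= in_itv/= -ler_norml => /fM h.
  by rewrite (le_trans h)// ltW.
have i0 : nu.-integrable D (EFin \o (fun=> 1 + kap * y ^+ 2)).
  exact: (ib _ `|1 + kap * y ^+ 2|).
have i1 : nu.-integrable D (EFin \o (fun x => x)) by exact: (ib _ eps).
have i2 : nu.-integrable D (EFin \o (fun x => x ^+ 2)).
  apply: (ib _ (eps ^+ 2)); first exact: measurable_funX.
  by move=> x xe; rewrite normrX ler_pXn2r// nnegrE// ltW.
have i1' : nu.-integrable D (EFin \o (fun x => 2 * kap * y * x)).
  exact: (integrableZl mD (2 * kap * y) i1).
have i2' : nu.-integrable D (EFin \o (fun x => kap * x ^+ 2)).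
  exact: (integrableZl mD kap i2).
have i12 : nu.-integrable D (EFin \o (fun x => 2 * kap * y * x + kap * x ^+ 2)).
  exact: (integrableD mD i1' i2').
have -> : (\int[nu]_(g in D) (1 + kap * (y + g) ^+ 2)%:E =
   (\int[nu]_(g in D) ((1 + kap * y ^+ 2) + (2 * kap * y * g + kap * g ^+ 2)))%R%:E)%E.
  rewrite /Rintegral fineK; last first.
    apply: integrable_fin_num => //; exact: (integrableD mD i0 i12).
  by apply: eq_integral => g _; congr EFin; ring.
have -> : \int[nu]_(g in D) (1 + kap * y ^+ 2 + (2 * kap * y * g + kap * g ^+ 2)) =
    (1 + kap * y ^+ 2) * fine (nu D) + kap * s.
  rewrite (RintegralD mD i0 i12) (RintegralD mD i1' i2').
  rewrite (RintegralZl (2 * kap * y) mD i1) (RintegralZl kap mD i2) nu1 nu2 mulr0 add0r.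
  by congr (_ + _); rewrite -Rintegral_cst.
have p1 : fine (nu D) <= 1.
  by rewrite -lee_fin fineK ?probability_le1// ge0_fin_numE.
rewrite lee_fin.
have -> : (1 + kap * s) * (1 + kap * y ^+ 2) =
  (1 + kap * y ^+ 2) + kap * s + kap ^+ 2 * y ^+ 2 * s by ring.
rewrite -addrA lerD ?ler_piMr//.
rewrite lerDl; apply: mulr_ge0; first by rewrite mulr_ge0 ?sqr_ge0.
by rewrite -nu2; apply: Rintegral_ge0 => x _; exact: sqr_ge0.
Qed.

End one_step.

Section expectation.
Context {R : realType} {d : measure_display} {Omega : measurableType d}.
Variable P : probability Omega R.
Variable G : nat -> {mfun Omega >-> R}.
Hypothesis indepG : forall (n : nat) (B : nat -> set R),
  (forall j, measurable (B j)) ->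
  P (\bigcap_(j in `I_n) (G j @^-1` B j)) = (\prod_(j < n) P (G j @^-1` B j))%E.

(** The generators of the sigma-algebra of the first [n] increments; they are
    closed under intersection, as [indep_generated] requires. *)
Definition past (n : nat) : set (set Omega) :=
  [set A | exists2 B : nat -> set R, (forall j, measurable (B j)) &
     A = \bigcap_(j in `I_n) (G j @^-1` B j)].

Lemma past_measurable n : past n `<=` measurable.
Proof.
move=> _ [B mB ->]; apply: fin_bigcap_measurable => // j _.
by rewrite -[X in measurable X]setTI; exact: measurable_funP.
Qed.

Lemma past_setT n : past n setT.
Proof.
exists (fun=> setT); first by move=> _; exact: measurableT.
by rewrite bigcapT// => j _; rewrite preimage_setT.
Qed.

Lemma past_setI n : setI_closed (past n).
Proof.
move=> _ _ [B mB ->] [B' mB' ->]; exists (fun j => B j `&` B' j).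
  by move=> j; exact: measurableI.
by rewrite -bigcapI.
Qed.

Lemma past_indep n A B : past n A -> measurable B ->
  P (A `&` G n @^-1` B) = (P A * P (G n @^-1` B))%E.
Proof.
move=> [B' mB' ->] mB.
pose C B0 j := if j == n then B0 else B' j.
have mC B0 : measurable B0 -> forall j, measurable (C B0 j).
  by move=> mB0 j; rewrite /C; case: ifP.
have CE B0 : \bigcap_(j in `I_n.+1) (G j @^-1` C B0 j) =
    \bigcap_(j in `I_n) (G j @^-1` B' j) `&` G n @^-1` B0.
  rewrite IIS bigcap_setU bigcap_set1 /C eqxx; congr (_ `&` _).
  by apply: eq_bigcapr => j /= jn; rewrite ltn_eqF.
rewrite -CE (indepG _ _ (mC B mB)) big_ord_recr/= {2}/C eqxx; congr (_ * _)%E.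
rewrite indepG//; apply: eq_bigr => j _; rewrite /C.
by rewrite ltn_eqF.
Qed.

Lemma measurable_past n j : (j < n)%N ->
  measurable_fun setT (G j : g_sigma_algebraType (past n) -> R).
Proof.
move=> jn _ B mB; rewrite setTI; apply: sub_sigma_algebra.
exists (fun k => if k == j then B else setT).
  by move=> k; case: ifP.
apply/seteqP; split => [w Bw k _|w /(_ j jn)]/=; last by rewrite eqxx.
by case: ifPn => // /eqP ->.
Qed.

Variables (r eps c kap s : R).
Hypotheses (r_gt : 1/2 < r) (eps0 : 0 < eps) (eps1 : eps < 1) (c0 : 0 <= c).
Hypothesis switch_le : forall z, r <= z <= r + eps ->
  c * (1 + kap * (z - 1) ^+ 2) <= 1 + kap * z ^+ 2.
Hypothesis quadratic_ge0 : forall z, 0 <= z <= r + eps -> 0 <= 1 + kap * z ^+ 2.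
Hypothesis G1 : forall j, \int[distribution P (G j)]_(x in `[- eps, eps]) x = 0.
Hypothesis G2 : forall j, \int[distribution P (G j)]_(x in `[- eps, eps]) x ^+ 2 = s.
Hypothesis s0 : 0 <= 1 + kap * s.

Lemma measurable_lyapunov d' (T : measurableType d') (H : nat -> T -> R) i :
  (forall j, (j < i)%N -> measurable_fun setT (H j)) ->
  measurable_fun setT (fun w => lyapunov r eps c kap (H ^~ w) i).
Proof.
move=> mH; apply: measurable_funM; first exact: measurable_weight.
apply: measurable_funD => //; apply: measurable_funM => //.
by apply: measurable_funX; exact: measurable_offset.
Qed.

(** The supermartingale property, iterated: given the past, one more step
    multiplies the expectation by at most [1 + kap * s]. *)
Lemma expectation_lyapunov n :
  (\int[P]_w (lyapunov r eps c kap (G ^~ w) n)%:E <= ((1 + kap * s) ^+ n)%:E)%E.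
Proof.
elim: n => [|n IH].
  rewrite /lyapunov/= expr0n/= mulr0 addr0 mulr1 expr0.
  by rewrite integral_cst// mul1e probability_le1.
(* The first n increments are read off the point w and the next one is the
   variable to be integrated out. *)
pose H j (z : g_sigma_algebraType (past n) * R) : R :=
  if (j < n)%N then G j z.1 else z.2.
pose Psi z := (lyapunov r eps c kap (H ^~ z) n.+1)%:E.
have -> : (\int[P]_w (lyapunov r eps c kap (G ^~ w) n.+1)%:E =
           \int[P]_w Psi (w, G n w))%E.
  apply: eq_integral => w _; rewrite /Psi /lyapunov; congr (_ * (1 + _ * _ ^+ _))%:E.
    by apply: weight_ext => j; rewrite ltnS leq_eqVlt /H => /orP[/eqP ->|->//]; rewrite ltnn.
  by apply: offset_ext => j; rewrite ltnS leq_eqVlt /H => /orP[/eqP ->|->//]; rewrite ltnn.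
have Psi_step z : (0 <= Psi z <= (weight r eps c (G ^~ z.1) n)%:E *
    (if `|z.2| <= eps then 1 + kap * (offset r (G ^~ z.1) n + z.2) ^+ 2 else 0)%:E)%E.
  have /andP[h1 h2] := lyapunov_step r eps c kap r_gt eps0 eps1 c0
    switch_le quadratic_ge0 (H ^~ z) n.
  rewrite lee_fin h1/= -EFinM lee_fin (le_trans h2)//.
  rewrite (@weight_ext _ _ _ _ _ (G ^~ z.1)); last by move=> j jn; rewrite /H jn.
  rewrite (@offset_ext _ _ _ (G ^~ z.1)); last by move=> j jn; rewrite /H jn.
  by rewrite /H ltnn.
rewrite (indep_fubini _ _ _ _ (past_measurable n) (past_setT n) (past_setI n)).
- apply: (@le_trans _ _ (\int[P]_w
      ((1 + kap * s)%:E * (lyapunov r eps c kap (G ^~ w) n)%:E)))%E.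
    apply: ge0_le_integral => //.
    + by move=> w _; apply: integral_ge0 => g _; have /andP[] := Psi_step (w, g).
    + apply: (@measurable_fun_fubini_tonelli_F _ _ _ _ _ (distribution P (G n))) => //.
      * apply/measurable_EFinP/measurable_lyapunov => j _.
        rewrite /H; case jn : (j < n)%N; last exact: measurable_snd.
        exact: (@measurableT_comp _ _ _ _ _ _ (G j)).
      * by move=> z; have /andP[] := Psi_step z.
    + apply: emeasurable_funM => //; apply/measurable_EFinP/measurable_lyapunov => j _.
      exact: measurable_funP.
    move=> w _; set D := `[(- eps)%R, eps]%classic.
    have mD : measurable D by exact: measurable_itv.
    have -> : (\int[distribution P (G n)]_g Psi (w, g) =
               \int[distribution P (G n)]_(g in D) Psi (w, g))%E.
      rewrite [RHS]integral_mkcond; apply: eq_integral => g _; rewrite patchE.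
      case: ifPn => // /negP; rewrite inE /D/= in_itv/= -ler_norml => /negP ge.
      have := Psi_step (w, g); rewrite /= (negbTE ge) mule0 => /andP[h1 h2].
      by apply/eqP; rewrite eq_le h1 h2.
    have [w0|w0] := eqVneq (weight r eps c (G ^~ w) n) 0.
      rewrite /lyapunov w0 mul0r mule0 (@eq_integral _ _ _ _ _ (cst 0%E)).
        by rewrite integral0.
      move=> g _; have := Psi_step (w, g); rewrite /= w0 mul0e => /andP[h1 h2].
      by apply/eqP; rewrite eq_le h1 h2.
    have mq : measurable_fun setT
        (fun g => 1 + kap * (offset r (G ^~ w) n + g) ^+ 2).
      apply: measurable_funD => //; apply: measurable_funM => //.
      by apply: measurable_funX; exact: measurable_funD.
    have ylt := @offset_lt _ r eps _ _ r_gt eps1 (@weight_neq0 _ _ _ _ _ _ w0).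
    have yle : 0 <= 1 + kap * offset r (G ^~ w) n ^+ 2.
      rewrite -real_normK ?num_real//; apply: quadratic_ge0; rewrite normr_ge0/=.
      by rewrite (le_trans (ltW ylt))// lerDl ltW.
    have w1 : 0 <= weight r eps c (G ^~ w) n by exact: weight_ge0.
    apply: (@le_trans _ _ (\int[distribution P (G n)]_(g in D)
       ((weight r eps c (G ^~ w) n)%:E *
        (1 + kap * (offset r (G ^~ w) n + g) ^+ 2)%:E)))%E.
      apply: ge0_le_integral => //.
      + by move=> g _; have /andP[] := Psi_step (w, g).
      + apply/measurable_EFinP; apply: (@measurable_funS _ _ _ _ setT) => //.
        apply: (@measurable_lyapunov _ _ (fun j g => H j (w, g))) => j _; rewrite /H.
        by case jn : (j < n)%N => /=; [exact: measurable_cst|exact: measurable_id].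
      + apply: emeasurable_funM => //; apply/measurable_EFinP.
        exact: (@measurable_funS _ _ _ _ setT).
      move=> g; rewrite /D/= in_itv/= -ler_norml => ge.
      by have := Psi_step (w, g); rewrite /= ge => /andP[].
    rewrite ge0_integralZl//; last 2 first.
      apply/measurable_EFinP; exact: (@measurable_funS _ _ _ _ setT).
      move=> g; rewrite /D/= in_itv/= -ler_norml => ge.
      rewrite lee_fin -real_normK ?num_real//; apply: quadratic_ge0; rewrite normr_ge0/=.
      by rewrite (le_trans (ler_normD _ _))// lerD// ltW.
    rewrite -EFinM /lyapunov mulrCA EFinM lee_wpmul2l// ?lee_fin//.
    by apply: (integral_quadratic _ _ _ _ _ (G1 n) (G2 n)).
  rewrite ge0_integralZl//.
  + by rewrite exprS EFinM lee_wpmul2l.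
  + apply/measurable_EFinP/measurable_lyapunov => j _.
    exact: measurable_funP.
  + by move=> w _; rewrite lee_fin; exact: lyapunov_ge0.
- exact: past_indep.
- by move=> w g; have /andP[] := Psi_step (w, g).
- apply/measurable_EFinP/measurable_lyapunov => j _.
  rewrite /H; case jn : (j < n)%N; last exact: measurable_snd.
  apply: (@measurableT_comp _ _ _ _ _ _ (G j : g_sigma_algebraType (past n) -> R)) => //.
  exact: measurable_past.
Qed.

End expectation.

(** * Truncated moments of the normal distribution *)

Section gaussian.
Context {R : realType}.
Local Notation mu := (@lebesgue_measure R).

(** The normal density is the Radon-Nikodym derivative of the normal
    distribution. *)
Lemma integral_normal_prob (m s : R) (f : R -> \bar R) (U : set R) :
  measurable U -> measurable_fun U f ->
  (\int[normal_prob m s]_(x in U) `|f x| < +oo)%E ->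
  (\int[normal_prob m s]_(x in U) f x =
   \int[mu]_(x in U) (f x * (normal_pdf m s x)%:E))%E.
Proof.
move=> mU mf finf.
rewrite -(Radon_Nikodym_change_of_variables (normal_prob_dominates m s))//=; last first.
  by apply/integrableP; split.
apply: ae_eq_integral => //.
- apply: emeasurable_funM => //; apply: (measurable_int mu).
  apply: (integrableS _ _ (@subsetT _ _)) => //=.
  by apply: Radon_Nikodym_integrable; exact: normal_prob_dominates.
- apply: emeasurable_funM => //=; apply/measurableT_comp => //=.
  by apply/measurable_funTS; exact: measurable_normal_pdf.
- apply: ae_eqe_mul2l => /=.
  rewrite Radon_NikodymE//=; first exact: normal_prob_dominates.
  move=> abmu.
  case: cid => /= h [h1 h2 h3].
  apply: integral_ae_eq => //=.
  + exact: integrableS h2.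
  + by apply/measurable_funTS/measurableT_comp =>//; exact: measurable_normal_pdf.
  + by move=> E E01 mE; rewrite -h3.
Qed.

Variable s : R.
Hypothesis s0 : 0 < s.
Let q := @normal_pdf R 0 s.

Let qE x : q x = normal_peak s * expR (- x ^+ 2 / (s ^+ 2 *+ 2)).
Proof. by rewrite /q normal_pdfE ?gt_eqF//= /normal_fun subr0. Qed.

Lemma is_derive_normal_pdf (x : R) : is_derive x 1 q (- x / s ^+ 2 * q x).
Proof.
rewrite (_ : q = (fun x => normal_peak s * expR (- x ^+ 2 / (s ^+ 2 *+ 2)))); last first.
  by apply/funext => y; rewrite qE.
apply: is_derive_eq.
rewrite /GRing.scale/=.
have s1 : s != 0 by rewrite gt_eqF.
by field.
Qed.

(** The integrand is the derivative of [- s ^+ 2 * q], an even function. *)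
Lemma integral_x_normal_pdf (A : R) : 0 < A ->
  (\int[mu]_(x in `[(- A)%R, A]) (x * q x)%:E = 0)%E.
Proof.
move=> A0.
have s1 : s != 0 by rewrite gt_eqF.
have cq : continuous q by exact: continuous_normal_pdf.
have cF : continuous (fun x => - s ^+ 2 * q x).
  by move=> x; apply: cvgM; [exact: cvg_cst|exact: cq].
rewrite (@continuous_FTC2 _ _ (fun x => - s ^+ 2 * q x)) /=.
- by rewrite !qE sqrrN -EFinB subrr.
- by rewrite gtrN.
- by apply: continuous_subspaceT => x; apply: cvgM; [exact: cvg_id|exact: cq].
- split.
  + by move=> x _; have := is_derive_normal_pdf x; move=> h; exact: ex_derive.
  + exact/cvg_at_right_filter/cF.
  + exact/cvg_at_left_filter/cF.
- move=> x _; rewrite derive1E; have h := is_derive_normal_pdf x.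
  rewrite derive_val /GRing.scale/=; by field.
Qed.

(** The integrand is the derivative of [- s ^+ 2 * (x * q x)]. *)
Lemma integral_sqr_normal_pdf (A : R) : 0 < A ->
  (\int[mu]_(x in `[(- A)%R, A]) ((x ^+ 2 - s ^+ 2) * q x)%:E = (- 2 * s ^+ 2 * A * q A)%:E)%E.
Proof.
move=> A0.
have s1 : s != 0 by rewrite gt_eqF.
have cq : continuous q by exact: continuous_normal_pdf.
have cF : continuous (fun x : R => - s ^+ 2 * (x * q x)).
  by move=> x; apply: cvgM; [exact: cvg_cst|apply: cvgM; [exact: cvg_id|exact: cq]].
rewrite (@continuous_FTC2 _ _ (fun x : R => - s ^+ 2 * (x * q x))) /=.
- by rewrite !qE sqrrN -EFinB; congr EFin; ring.
- by rewrite gtrN.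
- apply: continuous_subspaceT => x; apply: cvgM; last exact: cq.
  by apply: cvgB; [exact: exprn_continuous|exact: cvg_cst].
- split.
  + by move=> x _; have := is_derive_normal_pdf x; move=> h; exact: ex_derive.
  + exact/cvg_at_right_filter/cF.
  + exact/cvg_at_left_filter/cF.
- move=> x _; rewrite derive1E; have h := is_derive_normal_pdf x.
  rewrite derive_val /GRing.scale/=; by field.
Qed.

Lemma normal_peak_le : normal_peak s <= s^-1.
Proof.
rewrite /normal_peak lef_pV2 ?posrE//; last first.
  by rewrite sqrtr_gt0 mulrn_wgt0// mulr_gt0 ?pi_gt0// exprn_gt0.
have {1}<- : Num.sqrt (s ^+ 2) = s by rewrite sqrtr_sqr ger0_norm// ltW.
rewrite ler_sqrt; last first.
  by rewrite mulrn_wge0// mulr_ge0 ?pi_ge0// sqr_ge0.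
rewrite -mulrnAr ler_peMr ?sqr_ge0//.
by have := @pi_ge2 R; rewrite mulr2n; lra.
Qed.

Lemma expRN_le (u : R) : 0 < u -> expR (- u) <= u^-1.
Proof.
move=> u0; rewrite expRN lef_pV2 ?posrE ?expR_gt0//.
by rewrite (le_trans _ (expR_ge1Dx u))// lerDr.
Qed.

Let nu : probability (measurableTypeR R) R := normal_prob 0 s.

(** Outside of [[-A, A]], the density with deviation [s] is at most
    [6 * s ^+ 2 / A ^+ 2] times the density with deviation [2 * s], whose integral
    is at most [1]. *)
Lemma normal_prob_tail (A : R) : 0 < A ->
  1 - 6 * s ^+ 2 / A ^+ 2 <= fine (nu `[(- A)%R, A]%classic).
Proof.
move=> A0; set D := `[(- A)%R, A]%classic.
have mD : measurable D by exact: measurable_itv.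
have K0 : 0 <= 6 * s ^+ 2 / A ^+ 2.
  by apply: divr_ge0; [apply: mulr_ge0 => //|]; exact: sqr_ge0.
have tail : (nu (~` D) <= (6 * s ^+ 2 / A ^+ 2)%:E)%E.
  rewrite /nu/= /normal_prob.
  apply: (@le_trans _ _ (\int[mu]_(x in ~` D)
     ((6 * s ^+ 2 / A ^+ 2)%:E * (normal_pdf 0 (2 * s) x)%:E)))%E.
    apply: ge0_le_integral => //.
    - exact: measurableC.
    - by move=> x _; rewrite lee_fin normal_pdf_ge0.
    - apply/measurable_EFinP; apply: measurable_funTS.
      exact: measurable_normal_pdf.
    - apply: emeasurable_funM => //; apply/measurable_EFinP/measurable_funTS.
      exact: measurable_normal_pdf.
    - move=> x; rewrite /D/= in_itv/= -ler_norml => /negP; rewrite -ltNge => Ax.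
      rewrite -EFinM lee_fin.
      rewrite !normal_pdfE ?gt_eqF ?mulr_gt0// /normal_fun subr0.
      have -> : normal_peak s = 2 * normal_peak (2 * s).
        rewrite /normal_peak.
        have -> : (2 * s) ^+ 2 * pi *+ 2 = 2 ^+ 2 * (s ^+ 2 * pi *+ 2) by ring.
        rewrite (sqrtrM _ (sqr_ge0 2)) sqrtr_sqr ger0_norm//.
        by rewrite invfM mulrA divff// mul1r.
      have x2 : A ^+ 2 < x ^+ 2.
        by rewrite -[x ^+ 2]real_normK ?num_real// ltrXn2r//= ltW.
      have A2 : 0 < A ^+ 2 by rewrite exprn_gt0.
      have x0 : 0 < x ^+ 2 by exact: lt_trans x2.
      have s2 : 0 < s ^+ 2 by rewrite exprn_gt0.
      (* One quarter of the exponent belongs to the density of deviation 2 * s; the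
         rest is bounded by expR (- u) <= u^-1 and by A ^+ 2 < x ^+ 2. *)
      have -> : - x ^+ 2 / (s ^+ 2 *+ 2) =
          - x ^+ 2 / ((2 * s) ^+ 2 *+ 2) - (3 * x ^+ 2) / (8 * s ^+ 2).
        by field; rewrite gt_eqF.
      rewrite expRD.
      set p := normal_peak _; set e := expR (- x ^+ 2 / _); set e' := expR _.
      have p0 : 0 <= p by exact: normal_peak_ge0.
      have e0 : 0 <= e by exact: expR_ge0.
      have e'1 : e' <= 3 * s ^+ 2 / A ^+ 2.
        apply: le_trans (expRN_le _ _) _.
          by apply: divr_gt0; apply: mulr_gt0.
        have x3 : 0 < 3 * x ^+ 2 by apply: mulr_gt0.
        rewrite invf_div ler_pdivrMr//.
        rewrite mulrAC ler_pdivlMr//.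
        have : s ^+ 2 * A ^+ 2 < s ^+ 2 * x ^+ 2 by rewrite ltr_pM2l.
        have := mulr_gt0 s2 A2; lra.
      have -> : 6 * s ^+ 2 / A ^+ 2 * (p * e) = 2 * ((p * e) * (3 * s ^+ 2 / A ^+ 2)).
        by ring.
      have -> : 2 * p * (e * e') = 2 * ((p * e) * e') by ring.
      by rewrite ler_pM2l// ler_wpM2l// mulr_ge0.
  rewrite ge0_integralZl//.
  - rewrite -[leRHS]mule1; apply: lee_wpmul2l; first by rewrite lee_fin.
    rewrite -(integral_normal_pdf 0 (2 * s)).
    apply: ge0_subset_integral => //; first exact: measurableC.
      by apply/measurable_EFinP; exact: measurable_normal_pdf.
    by move=> x _; rewrite lee_fin normal_pdf_ge0.
  - exact: measurableC.
  - by apply/measurable_EFinP/measurable_funTS; exact: measurable_normal_pdf.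
  - by move=> x _; rewrite lee_fin normal_pdf_ge0.
have nufin : nu D \is a fin_num by exact: fin_num_measure.
have : nu (~` D) = (1 - nu D)%E by exact: probability_setC.
rewrite -(fineK nufin) -EFinB => h; move: tail; rewrite h lee_fin; lra.
Qed.

Lemma normal_trunc_mean (A : R) : 0 < A ->
  \int[nu]_(x in `[(- A)%R, A]) x = 0.
Proof.
move=> A0; set D := [set` _].
have mD : measurable D by exact: measurable_itv.
rewrite /Rintegral integral_normal_prob//.
- under eq_integral do rewrite -EFinM.
  by rewrite (integral_x_normal_pdf _ A0).
- apply: (@le_lt_trans _ _ (\int[nu]_(x in D) A%:E)%E).
    apply: ge0_le_integral => //.
    - by apply: measurableT_comp => //; exact: EFin_measurable.
    - move=> x; rewrite /D/= in_itv/= -ler_norml => xA.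
      by rewrite lee_fin.
  rewrite integral_cst//= lte_mul_pinfty ?lee_fin ?(ltW A0)//.
  by rewrite (le_lt_trans (probability_le1 _ _)) ?ltry.
Qed.

Lemma normal_trunc_var (A : R) : 0 < A ->
  s ^+ 2 * (1 - 4 * s / A - 6 * s ^+ 2 / A ^+ 2) <=
  \int[nu]_(x in `[(- A)%R, A]) x ^+ 2 <= s ^+ 2.
Proof.
move=> A0; set D := [set` _].
have mD : @measurable _ (measurableTypeR R) D by exact: measurable_itv.
have nufin : nu D \is a fin_num by exact: fin_num_measure.
have iq : mu.-integrable D (EFin \o q).
  apply: (@integrableS _ _ _ _ setT) => //; exact: integrable_normal_pdf.
have ix : mu.-integrable D (EFin \o (fun x => x ^+ 2 * q x)).
  apply: continuous_compact_integrable; first exact: segment_compact.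
  apply: continuous_subspaceT => x; apply: cvgM; first exact: exprn_continuous.
  by apply: continuous_normal_pdf; rewrite gt_eqF.
have -> : \int[nu]_(x in D) x ^+ 2 = \int[mu]_(x in D) (x ^+ 2 * q x).
  rewrite /Rintegral integral_normal_prob//.
  - by apply/measurable_EFinP/measurable_funTS; exact: measurable_funX.
  - apply: (@le_lt_trans _ _ (\int[nu]_(x in D) (A ^+ 2)%:E)%E).
      apply: ge0_le_integral => //.
      - apply: measurableT_comp => //.
        by apply/measurable_EFinP/measurable_funTS; exact: measurable_funX.
      - move=> x; rewrite /D/= in_itv/= -ler_norml => xA.
        by rewrite lee_fin normrX ler_pXn2r// nnegrE// ltW.
    rewrite integral_cst//= lte_mul_pinfty ?lee_fin ?sqr_ge0//.
    by rewrite (le_lt_trans (probability_le1 _ _)) ?ltry.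
have E : \int[mu]_(x in D) (x ^+ 2 * q x) = s ^+ 2 * (fine (nu D) - 2 * A * q A).
  have := integral_sqr_normal_pdf _ A0.
  move=> /(congr1 fine)/=.
  have -> : fine (\int[mu]_(x in D) ((x ^+ 2 - s ^+ 2) * q x)%:E) =
     \int[mu]_(x in D) (x ^+ 2 * q x) - s ^+ 2 * \int[mu]_(x in D) q x.
    rewrite -(RintegralZl (s ^+ 2) mD iq).
    rewrite -(RintegralB mD ix (integrableZl mD (s ^+ 2) iq)) /Rintegral.
    by congr fine; apply: eq_integral => x _; congr EFin; ring.
  have -> : \int[mu]_(x in D) q x = fine (nu D) by [].
  move=> h; rewrite mulrBr; lra.
rewrite E.
have t1 := normal_prob_tail _ A0.
have p1 : fine (nu D) <= 1 by rewrite -lee_fin fineK ?probability_le1.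
have q0 : 0 <= q A by exact: normal_pdf_ge0.
have q1 : 2 * A * q A <= 4 * s / A.
  have e1 : expR (- A ^+ 2 / (s ^+ 2 *+ 2)) <= 2 * s ^+ 2 / A ^+ 2.
    rewrite mulNr (le_trans (expRN_le _ _))//.
      by rewrite divr_gt0 ?exprn_gt0// pmulrn_lgt0// exprn_gt0.
    by rewrite invf_div mulr_natl.
  have qA : q A <= s^-1 * (2 * s ^+ 2 / A ^+ 2).
    by rewrite qE ler_pM ?normal_peak_ge0 ?expR_ge0// normal_peak_le.
  have -> : 4 * s / A = 2 * A * (s^-1 * (2 * s ^+ 2 / A ^+ 2)).
    by field; rewrite !gt_eqF.
  by rewrite ler_pM2l// mulr_gt0.
have s2 := sqr_ge0 s.
apply/andP; split.
  by rewrite ler_wpM2l//; move: t1 q1; rewrite -/D; lra.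
rewrite -[leRHS]mulr1 ler_wpM2l// lerBlDr (le_trans p1)// lerDl.
by apply: mulr_ge0 => //; apply: mulr_ge0 => //; exact: ltW.
Qed.

End gaussian.

(** * Stopping times of a continuous path *)

Lemma halfline_continuousP {R : realType} (x : R -> R) :
  {within `[0, +oo[, continuous x} ->
  forall t e, 0 <= t -> 0 < e ->
  exists2 d, 0 < d & forall s, 0 <= s -> `|s - t| < d -> `|x s - x t| < e.
Proof.
move=> cx t e t0 e0.
have := (subspace_continuousP _ _).1 cx t; rewrite /= in_itv/= andbT => /(_ t0).
move=> /cvgrPdist_lt/(_ _ e0); rewrite /within/= nearE.
move=> /nbhs_ballP[d /= d0 dP]; exists d => // s s0 sd.
rewrite distrC; apply: dP; first by rewrite /ball/= distrC.
by rewrite in_itv/= s0.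
Qed.

(** Heine's theorem on [[0, B]], by the near-covering form of compactness. *)
Lemma halfline_unif_continuous {R : realType} (x : R -> R) :
  {within `[0, +oo[, continuous x} ->
  forall B e : R, 0 < e ->
  exists2 d, 0 < d & forall s t, 0 <= s <= B -> 0 <= t <= B ->
    `|s - t| < d -> `|x s - x t| < e.
Proof.
move=> cx B e e0.
have := @segment_compact R 0 B; rewrite compact_near_coveringP => cov.
pose P (d t : R) := 0 <= t <= B -> forall s, 0 <= s <= B ->
  `|s - t| < d -> `|x s - x t| < e.
have : \forall d \near (0 : R)^'+, `[0, B] `<=` P d.
  apply: (cov _ _ P) => t; rewrite /= in_itv/= => /andP[t0 tB].
  have e2 : 0 < e / 2 by rewrite divr_gt0.
  have [d d0 dP] := halfline_continuousP _ cx t _ t0 e2.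
  have d2 : 0 < d / 2 by rewrite divr_gt0.
  (* Half of the radius at t is spent on moving the centre from t to t'. *)
  exists (ball t (d / 2), [set u | u < d / 2]).
    split => /=; first exact: nbhsx_ballx.
    by apply: nbhs_right_lt.
  move=> [t' d']/= [tt' dd'] /andP[t'0 t'B] s /andP[s0 sB] st.
  have h1 : `|x s - x t| < e / 2.
    apply: dP => //; rewrite -(subrKA t') (le_lt_trans (ler_normD _ _))//.
    rewrite [ltRHS]splitr ltrD ?(lt_trans st)//.
    by rewrite distrC.
  have h2 : `|x t' - x t| < e / 2.
    apply: dP => //; move: tt'; rewrite /ball/= distrC => tt'.
    by rewrite (lt_trans tt')// ltr_pdivrMr// ltr_pMr// ltr1n.
  rewrite -(subrKA (x t)) (le_lt_trans (ler_normD _ _))//.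
  by rewrite [ltRHS]splitr ltrD// distrC.
move=> H.
have [d [d0 dP]] : exists d : R, 0 < d /\ `[0, B] `<=` P d.
  near ((0 : R)^'+) => d; exists d; split => //.
  by near: d.
by exists d => // s t s0 t0; apply: (dP t) => //; rewrite /= in_itv.
Unshelve. all: by end_near. Qed.

Section hitting.
Context {R : realType} {Omega : Type} (X : R -> Omega -> R) (h : R) (w : Omega).
Hypothesis h0 : 0 < h.
Hypothesis X0 : X 0 w = 0.
Hypothesis cX : {within `[0, +oo[, continuous (fun t => X t w)}.
Local Notation x := (fun t => X t w).
Local Notation hit := (fun k => tau X h k w).

Lemma tau_le k t : (hit k <= t%:E)%E -> `|x t - x (fine (hit k))| = h ->
  (hit k.+1 <= t%:E)%E.
Proof. by move=> kt e; apply: ereal_inf_lbound; exists t. Qed.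

Lemma tau_leS k : (hit k <= hit k.+1)%E.
Proof. by apply: le_ereal_inf_tmp => _ [t [kt _] <-]. Qed.

Lemma tau_nondecreasing : {homo hit : i j / (i <= j)%N >-> (i <= j)%E}.
Proof. by apply: homo_leq => //; [exact: le_trans|exact: tau_leS]. Qed.

Lemma tau_ge0 k : (0 <= hit k)%E.
Proof. exact: (tau_nondecreasing _ _ (leq0n k)). Qed.

Lemma tau_fineK k t : (hit k <= t%:E)%E -> (fine (hit k))%:E = hit k.
Proof.
move=> kt; rewrite fineK// ge0_fin_numE ?tau_ge0//.
by rewrite (le_lt_trans kt) ?ltry.
Qed.

Lemma continuous_within_segment a b : 0 <= a -> {within `[a, b], continuous x}.
Proof.
move=> a0; apply: continuous_subspaceW cX => t/=; rewrite !in_itv/= andbT.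
by move=> /andP[+ _]; exact: le_trans.
Qed.

(** The path is continuous, so the set of times at which it is at the distance
    [h] from a point is closed and contains its infimum. *)
Lemma tau_attained k : (hit k.+1 < +oo)%E ->
  `|x (fine (hit k.+1)) - x (fine (hit k))| = h.
Proof.
move=> koo.
have bE : (fine (hit k.+1))%:E = hit k.+1 by rewrite fineK// ge0_fin_numE ?tau_ge0.
set b := fine (hit k.+1) in bE *; set a := fine (hit k).
have b0 : 0 <= b by rewrite -lee_fin bE tau_ge0.
apply/eqP/negP => /negP ne.
have e0 : 0 < `| `|x b - x a| - h| by rewrite normr_gt0 subr_eq0.
have [d d0 dP] := halfline_continuousP _ cX b _ b0 e0.
have : (hit k.+1 < (b + d)%:E)%E by rewrite -bE lte_fin ltrDl.
move=> /ereal_inf_lt[_ [t [kt te] <-]]; rewrite lte_fin => tbd.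
have bt : b <= t by rewrite -lee_fin bE; apply: tau_le.
have := dP t (le_trans b0 bt).
rewrite ger0_norm ?subr_ge0// ltrBlDl => /(_ tbd).
rewrite ltNge => /negP; apply.
have := ler_dist_dist (x b - x a) (x t - x a).
have -> : (x b - x a) - (x t - x a) = x b - x t by ring.
by rewrite te (distrC (X t w) (X b w)).
Qed.

(** A distance of at least [h] before the next stopping time would be exactly [h]
    at some earlier time, by the intermediate value theorem. *)
Lemma tau_before k t : (hit k <= t%:E < hit k.+1)%E ->
  `|x t - x (fine (hit k))| < h.
Proof.
move=> /andP[kt tk]; rewrite ltNge; apply/negP => ht.
set a := fine (hit k).
have aE : a%:E = hit k by exact: tau_fineK kt.
have a0 : 0 <= a by rewrite -lee_fin aE tau_ge0.
have at_ : a <= t by rewrite -lee_fin aE.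
have cy : {within `[a, t], continuous (fun s => `|x s - x a|)}.
  by move=> s; apply: cvg_norm; apply: cvgB; [exact: continuous_within_segment|exact: cvg_cst].
have [|c] := @IVT _ (fun s => `|x s - x a|) a t h at_ cy.
  by rewrite /= subrr normr0 ge_min le_max (ltW h0) ht orbT.
rewrite in_itv/= => /andP[ac ct] e.
have : (hit k.+1 <= c%:E)%E by apply: tau_le => //; rewrite -aE lee_fin.
by apply/negP; rewrite -ltNge (le_lt_trans _ tk)// lee_fin.
Qed.

Lemma tau_lattice k : (hit k < +oo)%E ->
  exists p : int, x (fine (hit k)) = h * p%:~R.
Proof.
elim: k => [_|k IH koo]; first by exists 0; rewrite /= X0 mulr0.
have [p pE] := IH (le_lt_trans (tau_leS k) koo).
have := tau_attained _ koo; rewrite pE /=.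
move: (X (fine (ereal_inf _)) w) => y.
have [y0|y0] := leP 0 (y - h * p%:~R).
  by rewrite ger0_norm// => e; exists (p + 1); rewrite intrD mulrDr mulr1; lra.
by rewrite ltr0_norm// => e; exists (p - 1); rewrite intrB mulrBr mulr1; lra.
Qed.

Lemma lattice_eq (p q : int) : `|h * p%:~R - h * q%:~R| < h -> p = q.
Proof.
rewrite -mulrBr normrM (gtr0_norm h0) -intrB -intr_norm.
rewrite -[ltRHS]mulr1 ltr_pM2l// (ltr_int R _ 1) => pq.
by apply/eqP; rewrite -subr_eq0 -normr_eq0; lia.
Qed.

(** Between two stopping times the path stays at a distance less than [h] from a
    lattice point, so it cannot visit two lattice points. *)
Lemma tau_le_crossing k t t' (p p' : int) : (hit k <= t%:E)%E -> t <= t' ->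
  x t = h * p%:~R -> x t' = h * p'%:~R -> p != p' -> (hit k.+1 <= t'%:E)%E.
Proof.
move=> kt tt' xt xt' pp'; rewrite leNgt; apply/negP => kt'.
have [q qE] := tau_lattice k (le_lt_trans kt (ltry t)).
have b1 : (hit k <= t%:E < hit k.+1)%E by rewrite kt (le_lt_trans _ kt')// lee_fin.
have b2 : (hit k <= t'%:E < hit k.+1)%E by rewrite kt' (le_trans kt)// lee_fin.
have := tau_before _ _ b1; have := tau_before _ _ b2.
rewrite qE xt xt' => /lattice_eq e1 /lattice_eq e2.
by rewrite e1 e2 eqxx in pp'.
Qed.

End hitting.

(** * Comparison of a path with its samples *)

(** The index of the lattice point from which [offset] measures. *)
Fixpoint anchor {R : realType} (r : R) (g : nat -> R) (i : nat) : int :=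
  if i is j.+1 then
    let z := offset r g j + g j in
    if r <= z then anchor r g j + 1 else
    if z <= - r then anchor r g j - 1 else anchor r g j
  else 0.

Lemma offset_anchor {R : realType} (r : R) g i :
  offset r g i + (anchor r g i)%:~R = \sum_(j < i) g j.
Proof.
elim: i => [|i IH]; first by rewrite big_ord0/= addr0.
rewrite big_ord_recr/= -IH /recenter; case: ifP => _; first by rewrite intrD; ring.
by case: ifP => _; rewrite ?intrB; ring.
Qed.

Lemma switches_nondecreasing {R : realType} (r : R) g :
  {homo switches r g : i j / (i <= j)%N}.
Proof. by apply: homo_leq => //; [exact: leq_trans|move=> i /=; exact: leq_addr]. Qed.

Lemma anchor_const {R : realType} (r : R) g i j : (i <= j)%N ->
  switches r g i = switches r g j -> anchor r g i = anchor r g j.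
Proof.
move=> /subnK <-; elim: (j - i)%N => [//|k IH]; rewrite addSn /=.
have := switches_nondecreasing r g i (k + i)%N (leq_addl _ _).
case: (leP r `|_|) => [zr|zr] le_s; first by rewrite addn1 => e; move: le_s; rewrite e ltnn.
rewrite addn0 => /IH ->.
by move: zr; rewrite ltr_norml => /andP[z1 z2]; rewrite leNgt z2 leNgt z1.
Qed.

Section sampling.
Context {R : realType} {Omega : Type} (X : R -> Omega -> R) (h : R) (w : Omega).
Hypothesis h0 : 0 < h.
Hypothesis X0 : X 0 w = 0.
Hypothesis cX : {within `[0, +oo[, continuous (fun t => X t w)}.
Variables (D eps : R) (M : nat) (g : nat -> R).
Hypotheses (D0 : 0 < D) (eps0 : 0 < eps) (eps4 : eps < 1/4).
Hypothesis gE : forall i, g i = (X (i.+1%:R * D) w - X (i%:R * D) w) / h.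
Hypothesis osc : forall s t, 0 <= s <= M%:R * D -> 0 <= t <= M%:R * D ->
  `|s - t| <= D -> `|X s w - X t w| <= eps * h.
Local Notation x := (fun t => X t w).
Local Notation hit := (fun k => tau X h k w).

Let sum_g i : \sum_(j < i) g j = X (i%:R * D) w / h.
Proof.
elim: i => [|i IH]; first by rewrite big_ord0 mul0r X0 mul0r.
by rewrite big_ord_recr/= IH gE; field; rewrite gt_eqF.
Qed.

Lemma sample_offset r i :
  X (i%:R * D) w = h * (offset r g i + (anchor r g i)%:~R).
Proof. by rewrite offset_anchor sum_g [RHS]mulrC divfK// gt_eqF. Qed.

Let grid_in i : (i <= M)%N -> 0 <= i%:R * D <= M%:R * D.
Proof.
move=> iM; apply/andP; split; first by apply: mulr_ge0 => //; exact: ltW.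
by rewrite ler_pM2r// ler_nat.
Qed.

Lemma small_increments i : (i < M)%N -> `|g i| <= eps.
Proof.
move=> iM; rewrite gE normrM normfV (gtr0_norm h0) ler_pdivrMr//.
apply: osc; [exact: grid_in|exact/grid_in/ltnW|].
by rewrite -mulrBl -natrB// subSnn mul1r gtr0_norm.
Qed.

(** With the radius [1 - eps] the samples count every move.  Just after the
    stopping time [tau k] the sample is within [eps * h] of a lattice point, while
    its offset is less than [1 - eps]; hence this lattice point is the anchor.
    Consecutive stopping points differ, so the anchor has changed in between, and
    this takes a switch. *)
Lemma tau_le_switches k : (hit k <= (M%:R * D)%:E)%E ->
  (k <= switches (1 - eps)%R g M)%N.
Proof.
set r := 1 - eps.
have r2 : 1/2 < r by move: (eps0) (eps4); rewrite /r; lra.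
have e1 : eps < 1 by move: eps4; lra.
suff H : (hit k <= (M%:R * D)%:E)%E -> exists j, [/\ (j <= M)%N,
    fine (hit k) <= j%:R * D < fine (hit k) + D, (k <= switches r g j)%N &
    X (fine (hit k)) w = h * (anchor r g j)%:~R].
  by move=> /H[j [jM _ kj _]]; rewrite (leq_trans kj)//; exact: switches_nondecreasing.
elim: k => [_|k IH kM].
  by exists 0%N; split => //; [rewrite mul0r lexx/= add0r|rewrite /= X0 mulr0].
have kM' : (hit k <= (M%:R * D)%:E)%E by exact: le_trans (tau_leS _ _ _ _) kM.
have [j [jM /andP[aj ja] kj xa]] := IH kM'.
have aE := tau_fineK _ _ _ _ _ kM'; have bE := tau_fineK _ _ _ _ _ kM.
have ab := tau_attained _ _ _ cX k (le_lt_trans kM (ltry _)).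
have [q qE] := tau_lattice _ _ _ X0 cX k.+1 (le_lt_trans kM (ltry _)).
have leab : fine (hit k) <= fine (hit k.+1) by rewrite -lee_fin aE bE tau_leS.
have b0 : 0 <= fine (hit k.+1) by rewrite -lee_fin bE tau_ge0.
have bM : fine (hit k.+1) <= M%:R * D by rewrite -lee_fin bE.
move: aj ja xa ab qE leab b0 bM.
set a := fine (hit k); set b := fine (hit k.+1) => aj ja xa ab qE leab b0 bM.
clear kM kM' IH aE bE.
(* The first sample taken at the time b or later. *)
have [j' /andP[bj' j'b]] : exists j' : nat, b <= j'%:R * D < b + D.
  have /andP[n1 n2] := truncn_itv (divr_ge0 b0 (ltW D0)).
  move: n1 n2; rewrite ler_pdivlMr// ltr_pdivrMr//.
  set n := Num.truncn _ => n1 n2; have [bn|bn] := eqVneq b (n%:R * D).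
    by exists n; rewrite -bn lexx ltrDl.
  exists n.+1; rewrite (ltW n2)/= -natr1 mulrDl mul1r ltrD2r lt_neqAle n1.
  by rewrite eq_sym bn.
have j'M : (j' <= M)%N.
  rewrite leqNgt; apply/negP => Mj'.
  have : M.+1%:R * D <= j'%:R * D by rewrite ler_pM2r// ler_nat.
  by rewrite -natr1 mulrDl; lra.
have jj' : (j <= j')%N.
  rewrite leqNgt; apply/negP => j'j.
  have : j'.+1%:R * D <= j%:R * D by rewrite ler_pM2r// ler_nat.
  by rewrite -natr1 mulrDl; lra.
have off : `|offset r g j'| < r.
  apply: (@offset_lt _ r eps) => //.
  by move=> i ij; apply: small_increments; exact: leq_trans j'M.
have near : `|X (j'%:R * D) w - X b w| <= eps * h.
  apply: osc; [exact: grid_in|by rewrite b0|].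
  by rewrite ger0_norm ?subr_ge0// lerBlDl ltW.
have xb : X b w = h * (anchor r g j')%:~R.
  rewrite qE; congr (_ * _%:~R); apply: (@lattice_eq _ h h0).
  rewrite -qE.
  have -> : X b w - h * (anchor r g j')%:~R =
    h * offset r g j' - (X (j'%:R * D) w - X b w).
    by rewrite (sample_offset r); ring.
  rewrite (le_lt_trans (ler_normB _ _))//.
  have : `|h * offset r g j'| < h * r by rewrite normrM (gtr0_norm h0) ltr_pM2l.
  by move: near; rewrite /r; lra.
exists j'; split => //; first by rewrite bj'.
rewrite (leq_ltn_trans kj)// ltn_neqAle switches_nondecreasing// andbT.
apply/negP => /eqP /(anchor_const _ _ _ _ jj') e.
by move: ab h0; rewrite /= xa xb e subrr normr0 => <-; rewrite ltxx.
Qed.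

(** With the radius [1 + eps] a switch proves a move.  When the anchor changes, the
    path has gone from within [h] of the old lattice point beyond the new one, so
    it has visited the new one in between, and [tau_le_crossing] applies to the
    visits of two successive anchors. *)
Lemma switches_tau_le :
  (hit (switches (1 + eps)%R g M) <= (M%:R * D)%:E)%E.
Proof.
set r := 1 + eps.
have r2 : 1/2 < r by move: (eps0) (eps4); rewrite /r; lra.
have e1 : eps < 1 by move: eps4; lra.
suff H i : (i <= M)%N -> exists t u, [/\ 0 <= t, t <= u <= i%:R * D,
    (hit (switches r g i) <= t%:E)%E, X t w = h * (anchor r g i)%:~R &
    `|X u w - h * (anchor r g i)%:~R| < h].
  have [t [u [_ /andP[tu uM] kt _ _]]] := H M (leqnn M).
  by rewrite (le_trans kt)// lee_fin (le_trans tu).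
elim: i => [_|i IH iM].
  by exists 0, 0; rewrite lexx mul0r lexx X0 /= mulr0 subrr normr0; split.
have [t [u [t0 /andP[tu ui] kt xt xu]]] := IH (ltnW iM).
have ii1 : i%:R * D <= i.+1%:R * D by rewrite ler_pM2r// ler_nat.
have u1 : u <= i.+1%:R * D by exact: le_trans ui ii1.
have off : `|offset r g i| < r.
  apply: (@offset_lt _ r eps) => //.
  by move=> j ij; apply: small_increments; exact: ltn_trans iM.
have gi := small_increments i iM.
set z := offset r g i + g i.
have zr : `|z| < r + eps by rewrite (le_lt_trans (ler_normD _ _))// ltr_leD.
have xz : X (i.+1%:R * D) w = h * (z + (anchor r g i)%:~R).
  have -> : X (i.+1%:R * D) w = X (i%:R * D) w + h * g i.
    by rewrite gE; field; rewrite gt_eqF.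
  by rewrite (sample_offset r); rewrite /z; ring.
have u0 : 0 <= u by exact: le_trans tu.
have [rz|zr'] := leP r `|z|; last first.
  have : ~~ (r <= `|z|) by rewrite -ltNge.
  move: zr'; rewrite ltr_norml => /andP[z1 z2] /negbTE zr'.
  exists t, u; rewrite /= -/z zr' addn0.
  rewrite [r <= z]leNgt z2 [z <= - r]leNgt z1.
  by split => //; rewrite tu.
(* A switch to p: the path has visited h * p between u and the next sample. *)
have step (p : int) : p != anchor r g i ->
    `|X (i.+1%:R * D) w - h * p%:~R| < h ->
    Num.min (X u w) (X (i.+1%:R * D) w) <= h * p%:~R <=
    Num.max (X u w) (X (i.+1%:R * D) w) ->
    exists t u, [/\ 0 <= t, t <= u <= i.+1%:R * D,
      (hit (switches r g i).+1 <= t%:E)%E, X t w = h * p%:~R &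
      `|X u w - h * p%:~R| < h].
  move=> pa xp mM.
  have [t' ] := @IVT _ x u (i.+1%:R * D) (h * p%:~R) u1
    (continuous_within_segment _ _ cX _ _ u0) mM.
  rewrite in_itv/= => /andP[ut' t'u] xt'.
  have tt' : t <= t' by exact: le_trans ut'.
  exists t', (i.+1%:R * D); split => //; first exact: le_trans tt'.
    by rewrite t'u lexx.
  apply: (tau_le_crossing _ _ _ h0 X0 cX _ t t' _ _ kt tt' xt xt').
  by rewrite eq_sym.
have pos : 0 < h * (r + eps - `|z|) by rewrite mulr_gt0// subr_gt0.
have neg : 0 <= h * (`|z| - r) by rewrite mulr_ge0 ?(ltW h0)// subr_ge0.
have he : h * eps < h * (1 / 4) by rewrite ltr_pM2l.
have he0 : 0 < h * eps by rewrite mulr_gt0.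
rewrite /= -/z rz addn1; clearbody z; move: xu; rewrite ltr_norml => /andP[xu1 xu2].
have [z0|z0] := leP 0 z.
  move: (rz) pos neg; rewrite (ger0_norm z0) => rz' pos neg; rewrite rz'.
  apply: step.
  - by rewrite -subr_eq0 addrAC subrr.
  - rewrite xz intrD ltr_norml; move: pos neg; rewrite /r !mulrBr !mulrDr; lra.
  - rewrite ge_min le_max xz intrD; move: pos neg; rewrite /r !mulrBr !mulrDr => pos neg.
    by apply/andP; split; apply/orP; [left|right]; lra.
move: (rz) pos neg; rewrite (ltr0_norm z0) => rz' pos neg.
have -> : (r <= z) = false by apply/negbTE; rewrite -ltNge; move: rz'; rewrite /r; lra.
have -> : z <= - r by lra.
apply: step.
- by rewrite -subr_eq0 addrAC subrr.
- rewrite xz intrB ltr_norml; move: pos neg; rewrite /r !mulrBr !mulrDr ?mulrBr; lra.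
- rewrite ge_min le_max xz intrB; move: pos neg; rewrite /r !mulrBr !mulrDr ?mulrBr => pos neg.
  by apply/andP; split; apply/orP; [right|left]; lra.
Qed.

End sampling.

(** * Numerical constants *)

Section constants.
Context {R : realType}.
Implicit Types x lam z : R.

Lemma expR_le_1D x : 0 <= x -> expR (x - x ^+ 2) <= 1 + x.
Proof.
move=> x0; rewrite -opprB expRN invf_ple ?posrE ?expR_gt0//; last by lra.
apply: le_trans (expR_ge1Dx _).
have x1 : 0 < 1 + x by lra.
rewrite -[leLHS]mul1r ler_pdivrMr//.
have -> : (1 + (x ^+ 2 - x)) * (1 + x) = 1 + x ^+ 3 by ring.
by rewrite lerDl exprn_ge0.
Qed.

Lemma expR_le_1B x : 0 <= x <= 1/2 -> expR (- (x + 2 * x ^+ 2)) <= 1 - x.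
Proof.
move=> /andP[x0 x2]; rewrite expRN invf_ple ?posrE ?expR_gt0//; last by lra.
apply: le_trans (expR_ge1Dx _).
have x1 : 0 < 1 - x by lra.
rewrite -[leLHS]mul1r ler_pdivrMr//.
have -> : (1 + (x + 2 * x ^+ 2)) * (1 - x) = 1 + x ^+ 2 * (1 - 2 * x) by ring.
by rewrite lerDl mulr_ge0 ?sqr_ge0//; lra.
Qed.

(** A lower bound for [(1 + lam * (1 - lam) ^+ 2) / (1 + lam ^+ 3)], the ratio of
    the quadratic function before and after a switch at the displacement
    [1 - lam]. *)
Definition up_factor lam : R := 1 + lam - 3 * lam ^+ 2.

(** The value of [1 - lam * y ^+ 2] at the largest displacement
    [y = 1 + 2 * lam] that an overshoot of [lam] allows. *)
Definition down_factor lam : R := 1 - lam * (1 + 2 * lam) ^+ 2.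

Section lam.
Variable lam : R.
Hypothesis lam01 : 0 < lam <= 1/8.
Let l0 : 0 < lam. Proof. by case/andP: lam01. Qed.
Let l1 : lam <= 1/8. Proof. by case/andP: lam01. Qed.
Let ll : lam ^+ 2 <= lam / 8.
Proof. by rewrite expr2 (ler_wpM2l (ltW l0))//; move: (l1); lra. Qed.
Let l20 : 0 < lam ^+ 2. Proof. by rewrite exprn_gt0. Qed.

Lemma up_factor_ge1 : 1 <= up_factor lam.
Proof. by move: (l0) (ll); rewrite /up_factor; lra. Qed.

Lemma up_factor_switch z : 1 - lam <= z <= 1 - lam + lam ->
  up_factor lam * (1 + lam * (z - 1) ^+ 2) <= 1 + lam * z ^+ 2.
Proof.
move=> /andP[z1 z2].
have h1 : (z - 1) ^+ 2 <= lam ^+ 2.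
  by rewrite -subr_ge0 subr_sqr mulr_ge0//; move: (l0); lra.
have h2 : (1 - lam) ^+ 2 <= z ^+ 2.
  by rewrite -subr_ge0 subr_sqr mulr_ge0//; move: (l0) (l1); lra.
have c0 := le_trans ler01 up_factor_ge1.
apply: (@le_trans _ _ (up_factor lam * (1 + lam * lam ^+ 2))).
  by rewrite ler_wpM2l// lerD2l ler_wpM2l// ltW.
apply: (@le_trans _ _ (1 + lam * (1 - lam) ^+ 2)); last first.
  by rewrite lerD2l ler_wpM2l// ltW.
rewrite -subr_ge0 /up_factor.
have -> : 1 + lam * (1 - lam) ^+ 2 - (1 + lam - 3 * lam ^+ 2) * (1 + lam * lam ^+ 2)
  = lam ^+ 2 * (1 - lam ^+ 2 + 3 * lam ^+ 3) by ring.
rewrite mulr_ge0 ?sqr_ge0// addr_ge0 ?mulr_ge0 ?exprn_ge0 ?ltW//.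
by move: (l1) (ll); lra.
Qed.

Let down_le : 1 - 13/8 * lam <= down_factor lam.
Proof.
rewrite /down_factor lerD2l lerN2 mulrC (ler_wpM2r (ltW l0))//.
rewrite (_ : (1 + 2 * lam) ^+ 2 = 1 + 4 * lam + 4 * lam ^+ 2); last by ring.
by move: (l1) (ll); lra.
Qed.

Lemma down_factor_ge0 : 0 <= down_factor lam.
Proof. by apply: le_trans down_le; move: (l1); lra. Qed.

Lemma down_factor_le1 : down_factor lam <= 1.
Proof. by rewrite /down_factor gerBl mulr_ge0 ?sqr_ge0// ltW. Qed.

Lemma down_factor_le z : 0 <= z <= 1 + lam + lam ->
  down_factor lam <= 1 + (- lam) * z ^+ 2.
Proof.
move=> /andP[z0 z1]; rewrite /down_factor mulNr lerD2l lerN2 (ler_wpM2l (ltW l0))//.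
by rewrite -subr_ge0 subr_sqr mulr_ge0//; move: (l0); lra.
Qed.

Lemma down_factor_switch z : 1 + lam <= z <= 1 + lam + lam ->
  down_factor lam * (1 + (- lam) * (z - 1) ^+ 2) <= 1 + (- lam) * z ^+ 2.
Proof.
move=> /andP[z0 z1]; apply: (@le_trans _ _ (down_factor lam)).
  by rewrite ler_piMr ?down_factor_ge0// mulNr gerBl mulr_ge0 ?sqr_ge0// ltW.
by apply: down_factor_le; rewrite z1 andbT; move: (z0) (l0); lra.
Qed.

Lemma expR_le_up_factor : expR (lam - 4 * lam ^+ 2) <= up_factor lam.
Proof.
set x := lam - 3 * lam ^+ 2.
have x0 : 0 <= x by rewrite /x; move: (ll) (l0); lra.
have -> : up_factor lam = 1 + x by rewrite /up_factor /x; ring.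
apply: le_trans (expR_le_1D _ x0); rewrite ler_expR /x.
have : (lam - 3 * lam ^+ 2) ^+ 2 <= lam ^+ 2.
  rewrite ler_pXn2r ?nnegrE ?(ltW l0)//; last by move: (l20); lra.
by lra.
Qed.

Lemma expR_le_down_factor : expR (- (lam + 11 * lam ^+ 2)) <= down_factor lam.
Proof.
pose x := lam * (1 + 2 * lam) ^+ 2.
have xE : x = lam + 4 * lam ^+ 2 + 4 * (lam * lam ^+ 2) by rewrite /x; ring.
have l30 : 0 <= lam * lam ^+ 2 by rewrite mulr_ge0 ?ltW.
have l3 : lam * lam ^+ 2 <= lam ^+ 2 / 8.
  by rewrite mulrC ler_wpM2l ?(ltW l20)//; move: (l1); lra.
have x13 : x <= 13/8 * lam by rewrite xE; move: (ll) (l3); lra.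
have x0 : 0 <= x by rewrite xE; move: (l0) (l20); lra.
have x2 : x ^+ 2 <= (13/8 * lam) ^+ 2 by rewrite ler_pXn2r ?nnegrE// (le_trans x0).
apply: le_trans (expR_le_1B x _); last by rewrite x0; move: (l1) (x13); lra.
rewrite ler_expR lerN2.
have x2' : x ^+ 2 <= (13 / 8) ^+ 2 * lam ^+ 2 by rewrite -exprMn.
by move: x2' (l20) (l3); rewrite {2}xE; lra.
Qed.

End lam.

(** Each case uses one of the two terms: the exponents are
    [lam * (j - N)] and [lam * (N - j)] up to multiples of [lam ^+ 2 * N = 1 / 64]
    and of [lam] and [lam ^+ 2 * (j - N)], which are absorbed by half of the linear
    term and by the constant [- 1]. *)
Lemma deviation_le (N lam : R) (j : nat) : 2 <= N -> (2 <= j)%N ->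
  lam = (8 * Num.sqrt N)^-1 ->
  expR (`|j%:R - N| / Num.sqrt N / 16 - 1) <=
  expR (- lam * N) * up_factor lam ^+ (j - 2) +
  expR (lam * N) * down_factor lam ^+ j.
Proof.
move=> N2 j2 lamE; set q := Num.sqrt N; rewrite -/q in lamE.
have N0 : 0 < N by lra.
have q0 : 0 < q by rewrite sqrtr_gt0.
have qq : q ^+ 2 = N by rewrite sqr_sqrtr// ltW.
have q1 : 1 <= q by rewrite -sqrtr1 ler_sqrt//; lra.
have l01 : 0 < lam <= 1/8.
  rewrite lamE invr_gt0 mulr_gt0//= invfM mul1r -[leRHS]mulr1 ler_wpM2l//.
  by rewrite invf_le1.
have /andP[l0 l1] := l01.
have lN : lam ^+ 2 * N = 1 / 64.
  by rewrite -qq lamE; field; rewrite gt_eqF.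
have l20 : 0 <= lam ^+ 2 by exact: sqr_ge0.
have aE a : a / q / 16 = lam * a / 2.
  by rewrite lamE; field; rewrite gt_eqF.
rewrite aE.
have [jN|jN] := leP N j%:R.
  apply: (@le_trans _ _ (expR (- lam * N) * up_factor lam ^+ (j - 2))); last first.
    rewrite lerDl mulr_ge0 ?expR_ge0// exprn_ge0//; exact: down_factor_ge0.
  apply: (@le_trans _ _ (expR (- lam * N) * expR (lam - 4 * lam ^+ 2) ^+ (j - 2))).
    rewrite -expRM_natl -expRD ler_expR ger0_norm ?subr_ge0// natrB//.
    have : 4 * lam ^+ 2 * (j%:R - N) <= (lam / 2) * (j%:R - N).
      rewrite ler_wpM2r ?subr_ge0//.
      by rewrite expr2; have := ler_wpM2l (ltW l0) l1; lra.
    by move: (lN) (l0) (l1) (l20); lra.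
  rewrite ler_wpM2l ?expR_ge0// lerXn2r ?nnegrE ?expR_ge0//.
    by rewrite (le_trans ler01)// up_factor_ge1.
  exact: expR_le_up_factor.
apply: (@le_trans _ _ (expR (lam * N) * down_factor lam ^+ j)); last first.
  by rewrite lerDr mulr_ge0 ?expR_ge0// exprn_ge0// (le_trans ler01)// up_factor_ge1.
apply: (@le_trans _ _ (expR (lam * N) * expR (- (lam + 11 * lam ^+ 2)) ^+ j)).
  rewrite -expRM_natl -expRD ler_expR ltr0_norm ?subr_lt0//.
  have : 0 < lam * (N - j%:R) by rewrite mulr_gt0// subr_gt0.
  have : lam ^+ 2 * j%:R <= lam ^+ 2 * N by rewrite ler_wpM2l// ltW.
  by rewrite lN; lra.
rewrite ler_wpM2l ?expR_ge0// lerXn2r ?nnegrE ?expR_ge0//.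
  exact: down_factor_ge0.
exact: expR_le_down_factor.
Qed.

(** From [u <= expR u] at [u = z / (16 * K)], raised to the power [K]. *)
Lemma powR_le_expR (K z : R) : 0 < K -> 0 <= z ->
  z `^ K <= (16 * K) `^ K * expR (z / 16).
Proof.
move=> K0 z0.
have K16 : 0 < 16 * K by rewrite mulr_gt0.
have : z <= 16 * K * expR (z / (16 * K)).
  rewrite -ler_pdivrMl// mulrC (le_trans _ (expR_ge1Dx _))// lerDr//.
move=> /(ge0_ler_powR (ltW K0)) H.
have e0 : 0 <= 16 * K * expR (z / (16 * K)).
  by apply: mulr_ge0; [exact: ltW|exact: expR_ge0].
apply: le_trans (H _ _) _; rewrite ?nnegrE//.
rewrite (powRM _ (ltW K16) (expR_ge0 _)) ler_wpM2l ?powR_ge0//.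
rewrite /powR gt_eqF ?expR_gt0// expRK ler_expR.
by rewrite le_eqVlt; apply/orP; left; apply/eqP; field; rewrite gt_eqF.
Qed.

End constants.

(** * Passage to the limit *)

Lemma limn_einf_ge {R : realType} (u : (\bar R)^nat) (a : \bar R) (n0 : nat) :
  (forall n, (n0 <= n)%N -> (a <= u n)%E) -> (a <= limn_einf u)%E.
Proof.
move=> au; rewrite limn_einf_lim; apply: lime_ge; first exact: is_cvg_einfs.
near=> n; apply: le_ereal_inf_tmp => _ [k /= nk <-]; apply: au.
by apply: leq_trans nk; near: n; exists n0.
Unshelve. all: by end_near. Qed.

(** The integral of a nonnegative function is a supremum over simple functions
    below it, so [f] need not be measurable; making [g] infinite on a null set
    turns the almost sure bound into a sure one. *)
Lemma le_integral_ae {R : realType} {d : measure_display}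
    {T : measurableType d} (mu : {measure set T -> \bar R}) (f g : T -> \bar R) :
  (forall t, 0 <= f t)%E -> (forall t, 0 <= g t)%E -> measurable_fun setT g ->
  {ae mu, forall t, (f t <= g t)%E} ->
  (\int[mu]_t f t <= \int[mu]_t g t)%E.
Proof.
move=> f0 g0 mg [N [mN N0 fgN]].
pose g' t := if t \in N then +oo%E else g t.
have mg' : measurable_fun setT g'.
  apply: measurable_fun_ifT => //.
  apply: (measurable_fun_bool true) => //; rewrite setTI.
  rewrite [X in measurable X](_ : _ = N)//.
  by apply/seteqP; split => t /=; [move/set_mem|move/mem_set].
have g'0 t : (0 <= g' t)%E by rewrite /g'; case: ifP => // _; exact: leey.
have fg' t : (f t <= g' t)%E.
  rewrite /g'; case: ifPn => [_|]; first exact: leey.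
  by move=> /negP; rewrite inE; apply: contra_notP => nfg; apply: fgN.
have -> : (\int[mu]_t g t = \int[mu]_t g' t)%E.
  apply: ae_eq_integral => //.
  exists N; split => // t /= /not_implyP[_ gg']; apply: contrapT => Nt; apply: gg'.
  by rewrite /g' memNset.
rewrite ge0_integralTE// ge0_integralTE//.
apply: ereal_sup_le => _ [k kf <-]; exists k => // t.
exact: le_trans (kf t) (fg' t).
Qed.

Lemma fatou_ae {R : realType} {d : measure_display} {T : measurableType d}
    (mu : {measure set T -> \bar R}) (u : nat -> T -> \bar R) (f : T -> \bar R) C :
  (forall n, measurable_fun setT (u n)) -> (forall n t, 0 <= u n t)%E ->
  (forall t, 0 <= f t)%E ->
  {ae mu, forall t, (f t <= limn_einf (u ^~ t))%E} ->
  (forall n, \int[mu]_t u n t <= C)%E ->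
  (\int[mu]_t f t <= C)%E.
Proof.
move=> mu_ u0 f0 fu uC.
apply: le_trans (le_integral_ae mu f (fun t => limn_einf (u ^~ t)) _ _ _ _) _ => //.
- by move=> t; apply: (limn_einf_ge _ _ 0%N).
- apply: measurableT_comp => //; apply: measurable_fun_limn_esup => n.
  exact: measurableT_comp.
apply: le_trans (fatou mu measurableT mu_ _) _; first by move=> n t _; exact: u0.
rewrite limn_einf_lim; apply: lime_le; first exact: is_cvg_einfs.
apply: nearW => n; apply: le_trans (uC n).
by apply: ereal_inf_lbound; exists n => /=.
Qed.

(** * Sampled increments of a Brownian motion *)

Definition increment {R : realType} {Omega : Type} (W : R -> Omega -> R)
  (D c : R) (j : nat) (w : Omega) : R := (W (j.+1%:R * D) w - W (j%:R * D) w) / c.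

Section increments.
Context {R : realType} {d : measure_display} {Omega : measurableType d}.
Variables (P : probability Omega R) (W : R -> Omega -> R).
Hypothesis bm : brownian_motion P W.
Variables (D c : R).
Hypotheses (D0 : 0 < D) (c0 : 0 < c).

Lemma measurable_increment j : measurable_fun setT (increment W D c j).
Proof.
by apply: measurable_funM => //; apply: measurable_funB;
  apply: (bm_measurable bm); rewrite mulr_ge0 ?ler0n ?ltW.
Qed.

Let G j : {mfun Omega >-> R} :=
  HB.pack (increment W D c j) (isMeasurableFun.Build _ _ _ _ _ (measurable_increment j)).

Let scale : measurableTypeR R -> R := fun z => z / c.
Let measurable_scale : measurable_fun setT scale.
Proof. exact: measurable_funM. Qed.
Let Scale : {mfun measurableTypeR R >-> R} :=
  HB.pack scale (isMeasurableFun.Build _ _ _ _ _ measurable_scale).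

Lemma increment_independent (n : nat) (B : nat -> set R) :
  (forall j, measurable (B j)) ->
  P (\bigcap_(j in `I_n) (G j @^-1` B j)) = (\prod_(j < n) P (G j @^-1` B j))%E.
Proof.
move=> mB.
have nd : nondecreasing_seq (fun j : nat => j%:R * D).
  by move=> i j ij; rewrite ler_pM2r// ler_nat.
have t0 : 0 <= (fun j : nat => j%:R * D) 0%N by rewrite mul0r.
have := @bm_independent_increments _ _ _ _ _ bm n _ t0 nd (fun i => scale @^-1` B i).
rewrite (_ : \bigcap_(i in [set: 'I_n]) _ = \bigcap_(j in `I_n) (G j @^-1` B j)).
  by apply => i; rewrite -[X in measurable X]setTI; exact: measurable_scale.
apply/seteqP; split => w H.
  by move=> j /= jn; exact: (H (Ordinal jn) I).
by move=> i _; exact: (H i (ltn_ord i)).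
Qed.

Let nu : probability (measurableTypeR R) R := normal_prob 0 (Num.sqrt D).

Lemma increment_law j A : measurable A ->
  distribution P (G j) A = distribution nu Scale A.
Proof.
move=> mA; rewrite /distribution /pushforward/=.
have lt_jj : j%:R * D < j.+1%:R * D by rewrite ltr_pM2r// ltr_nat.
have j0 : 0 <= j%:R * D by rewrite mulr_ge0// ltW.
have mB : measurable (scale @^-1` A).
  by rewrite -[X in measurable X]setTI; exact: measurable_scale.
have := @bm_gaussian_increments _ _ _ _ _ bm _ _ j0 lt_jj _ mB.
by rewrite -mulrBl -natrB// subSnn mul1r.
Qed.

Lemma integrable_trunc (f : R -> R) (M A : R) : measurable_fun setT f ->
  (forall z, `|z| <= A -> `|f z| <= M) ->
  nu.-integrable `[- A, A]%classic (EFin \o f).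
Proof.
move=> mf fM; pose I : set (measurableTypeR R) := `[- A, A]%classic.
have mI : measurable I by exact: measurable_itv.
suff : nu.-integrable I (EFin \o (f : measurableTypeR R -> R)) by [].
apply: measurable_bounded_integrable => //.
- by rewrite (le_lt_trans (probability_le1 _ _)) ?ltry.
- exact: measurable_funTS.
exists M; split; first exact: num_real.
move=> y My z; rewrite /I /= in_itv/= -ler_norml => /fM zM.
exact: le_trans zM (ltW My).
Qed.

Lemma Rintegral_increment j (f : R -> R) (eps M : R) : measurable_fun setT f ->
  (forall x, `|x| <= eps -> `|f x| <= M) ->
  \int[distribution P (G j)]_(x in `[- eps, eps]) f x =
  \int[nu]_(z in `[- (eps * c), eps * c]) f (z / c).
Proof.
move=> mf fM; rewrite /Rintegral; congr fine.
rewrite (eq_measure_integral (distribution nu Scale)); last first.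
  by move=> A mA _; exact: increment_law.
have pre : Scale @^-1` `[- eps, eps] = `[- (eps * c), eps * c]%classic.
  apply/seteqP; split => z; rewrite /= !in_itv/= /scale -mulNr.
    by rewrite ler_pdivlMr// ler_pdivrMr.
  by rewrite ler_pdivlMr// ler_pdivrMr.
rewrite /distribution integral_pushforward//.
- by rewrite pre.
- apply/measurable_EFinP; exact: measurable_funTS.
rewrite pre.
apply: (integrable_trunc (fun z => f (z / c)) M).
  exact: (@measurableT_comp _ _ _ _ _ _ f _ scale).
move=> z; rewrite ler_norml => /andP[z1 z2].
apply: fM; rewrite ler_norml; apply/andP; split.
  by rewrite ler_pdivlMr// mulNr.
by rewrite ler_pdivrMr.
Qed.

Variable eps : R.
Hypothesis eps0 : 0 < eps.

Definition truncated_variance : R :=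
  c ^- 2 * \int[nu]_(z in `[- (eps * c), eps * c]) z ^+ 2.

Let sD0 : 0 < Num.sqrt D. Proof. by rewrite sqrtr_gt0. Qed.
Let ec0 : 0 < eps * c. Proof. exact: mulr_gt0. Qed.

(** The truncation at [eps] is negligible when the deviation [Num.sqrt D / c] of
    an increment is small with respect to [eps]. *)
Lemma truncated_variance_bounds :
  D / c ^+ 2 * (1 - 4 * Num.sqrt D / (eps * c) - 6 * D / (eps * c) ^+ 2) <=
  truncated_variance <= D / c ^+ 2.
Proof.
have := normal_trunc_var _ sD0 _ ec0; rewrite (sqr_sqrtr (ltW D0)) => /andP[v1 v2].
have c2 : 0 <= c ^- 2 by rewrite invr_ge0 sqr_ge0.
rewrite /truncated_variance (mulrC D (c ^- 2)); apply/andP; split.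
  by rewrite -[leLHS]mulrA; exact: ler_wpM2l.
exact: ler_wpM2l.
Qed.

Variables (r cc kap : R).
Hypotheses (r_gt : 1/2 < r) (eps1 : eps < 1) (cc0 : 0 <= cc).
Hypothesis switch_le : forall z, r <= z <= r + eps ->
  cc * (1 + kap * (z - 1) ^+ 2) <= 1 + kap * z ^+ 2.
Hypothesis quadratic_ge0 : forall z, 0 <= z <= r + eps -> 0 <= 1 + kap * z ^+ 2.
Hypothesis s0 : 0 <= 1 + kap * truncated_variance.

Lemma expectation_lyapunov_increment M :
  (\int[P]_w (lyapunov r eps cc kap (increment W D c ^~ w) M)%:E <=
   ((1 + kap * truncated_variance) ^+ M)%:E)%E.
Proof.
apply: (@expectation_lyapunov R _ Omega P G) => //.
- exact: increment_independent.
- move=> j; rewrite (Rintegral_increment j id eps eps)//.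
  transitivity (c^-1 * \int[nu]_(z in `[- (eps * c), eps * c]) z).
    rewrite -RintegralZl//.
      by apply: eq_Rintegral => z _; rewrite mulrC.
    exact: (integrable_trunc id (eps * c)).
  by rewrite normal_trunc_mean// mulr0.
- move=> j; rewrite (Rintegral_increment j (fun x => x ^+ 2) eps (eps ^+ 2))//.
    rewrite /truncated_variance -RintegralZl//.
      by apply: eq_Rintegral => z _; rewrite expr_div_n mulrC.
    apply: (integrable_trunc (fun z => z ^+ 2) ((eps * c) ^+ 2)).
      exact: measurable_funX.
    by move=> x xe; rewrite normrX ler_pXn2r// nnegrE// ltW.
  by move=> x xe; rewrite normrX ler_pXn2r// nnegrE// ltW.
Qed.

End increments.

(** * The potential controlling both tails *)

(** If no stopping time of even positive index exceeds [theta], then none does, and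
    [first_even_after] is the infimum of the empty set. *)
Lemma first_even_afterP {R : realType} {Omega : Type} (X : R -> Omega -> R)
    (h theta : R) (w : Omega) : 0 <= theta ->
  (exists j, [/\ (2 <= j)%N, first_even_after X h theta w = (j%:R)%:E,
     (theta%:E < tau X h j w)%E & (tau X h (j - 2) w <= theta%:E)%E]) \/
  (first_even_after X h theta w = +oo%E /\
   forall k, (tau X h k w <= theta%:E)%E).
Proof.
move=> th0.
pose S j := positive_even j /\ (theta%:E < tau X h j w)%E.
have [exS|noS] := pselect (exists j, S j); [left|right].
  have exb : exists j, `[< S j >] by have [j Sj] := exS; exists j; exact/asboolP.
  case: (ex_minnP exb) => j /asboolP[[j0 jodd] jt] jmin.
  have j2 : (2 <= j)%N by case: j j0 jodd {jt jmin} => [|[|]].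
  exists j; split => //.
    apply/eqP; rewrite eq_le; apply/andP; split.
      by apply: ereal_inf_lbound; exists j.
    apply: le_ereal_inf_tmp => _ [k Sk <-]; rewrite lee_fin ler_nat.
    by apply: jmin; exact/asboolP.
  have [->|j2'] := eqVneq j 2%N; first by rewrite subnn lee_fin.
  rewrite leNgt; apply/negP => lt2.
  have := jmin (j - 2)%N; rewrite leqNgt => /(_ _)/negP; apply; last by lia.
  apply/asboolP; split => //; split; first by lia.
  by rewrite oddB//= addbF.
have le_th j : positive_even j -> (tau X h j w <= theta%:E)%E.
  by move=> je; rewrite leNgt; apply/negP => jt; apply: noS; exists j.
split.
  rewrite /first_even_after; set A := (A in ereal_inf A).
  have -> : A = set0; last by rewrite ereal_inf0.
  by apply/seteqP; split => // y [j Sj _]; case: noS; exists j.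
move=> k; apply: (@le_trans _ _ (tau X h k.*2.+2 w)).
  by apply: tau_nondecreasing; lia.
by apply: le_th; split => //=; rewrite negbK odd_double.
Qed.

Section potential.
Context {R : realType}.
Variables (lam N : R).
Hypothesis lam01 : 0 < lam <= 1/8.
Let l0 : 0 < lam. Proof. by case/andP: lam01. Qed.
Let l1 : lam <= 1/8. Proof. by case/andP: lam01. Qed.

Definition up_lyapunov := lyapunov (1 - lam) lam (up_factor lam) lam.
Definition down_lyapunov := lyapunov (1 + lam) lam (down_factor lam) (- lam).
(** Up to a constant factor, its value at the samples of a path bounds from above
    the exponential of the deviation of [J] in either direction
    ([potential_ge_factors] with [deviation_le]), while its expectation is bounded
    ([expectation_potential]). *)
Definition potential (g : nat -> R) (M : nat) : R :=
  expR (- lam * N) * up_lyapunov g M + expR (lam * N) * down_lyapunov g M.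

Lemma up_lyapunov_ge0 g M : 0 <= up_lyapunov g M.
Proof.
apply: lyapunov_ge0 => //; try by (move: (l0) (l1); lra).
- by rewrite (le_trans ler01)// up_factor_ge1.
- exact: up_factor_switch.
- by move=> z _; rewrite addr_ge0// mulr_ge0 ?sqr_ge0// ltW.
Qed.

Lemma down_lyapunov_ge0 g M : 0 <= down_lyapunov g M.
Proof.
apply: lyapunov_ge0 => //; try by (move: (l0) (l1); lra).
- exact: down_factor_ge0.
- exact: down_factor_switch.
- move=> z zr; apply: le_trans (down_factor_le _ lam01 _ zr).
  exact: down_factor_ge0.
Qed.

Lemma potential_ge (g : nat -> R) M : (forall i, (i < M)%N -> `|g i| <= lam) ->
  expR (- lam * N) * up_factor lam ^+ switches (1 - lam) g M +
  expR (lam * N) * down_factor lam ^+ (switches (1 + lam) g M).+1 <= potential g M.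
Proof.
move=> gM; rewrite /potential /up_lyapunov /down_lyapunov /lyapunov !weightE//.
have e1 : lam < 1 by move: (l1); lra.
apply: lerD; rewrite ler_wpM2l ?expR_ge0//.
  rewrite ler_peMr ?exprn_ge0 ?(le_trans ler01 (up_factor_ge1 _ lam01))//.
  by rewrite lerDl mulr_ge0 ?sqr_ge0// ltW.
rewrite exprSr ler_wpM2l ?exprn_ge0 ?down_factor_ge0//.
have off : `|offset (1 + lam) g M| < 1 + lam.
  by apply: (@offset_lt _ _ lam) => //; move: (l0); lra.
rewrite -[offset _ _ _ ^+ 2]real_normK ?num_real//; apply: down_factor_le => //.
by rewrite normr_ge0/= (le_trans (ltW off))// lerDl ltW.
Qed.

Section path.
Context {Omega : Type} (X : R -> Omega -> R) (h D : R) (M : nat) (w : Omega).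
Context (g : nat -> R).
Hypotheses (h0 : 0 < h) (X0 : X 0 w = 0).
Hypothesis cX : {within `[0, +oo[, continuous (fun t => X t w)}.
Hypothesis D0 : 0 < D.
Hypothesis gE : forall i, g i = (X (i.+1%:R * D) w - X (i%:R * D) w) / h.
Hypothesis osc : forall s t, 0 <= s <= M%:R * D -> 0 <= t <= M%:R * D ->
  `|s - t| <= D -> `|X s w - X t w| <= lam * h.
Let horizon := M%:R * D.

(** If [J = j], this is used with [k = j - 2]: the stopping time of the even index
    [j - 2] has not passed the horizon, and that of index [j] has. *)
Lemma potential_ge_factors k j :
  (tau X h k w <= horizon%:E)%E ->
  (horizon%:E < tau X h j w)%E ->
  expR (- lam * N) * up_factor lam ^+ k +
  expR (lam * N) * down_factor lam ^+ j <= potential g M.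
Proof.
move=> kth thj.
have lam4 : lam < 1/4 by move: (l1); lra.
have small := small_increments X h w h0 D lam M g D0 gE osc.
apply: le_trans (potential_ge g M small).
have kU := tau_le_switches X h w h0 X0 cX D lam M g D0 l0 lam4 gE osc k kth.
have kL := switches_tau_le X h w h0 X0 cX D lam M g D0 l0 lam4 gE osc.
apply: lerD; rewrite ler_wpM2l ?expR_ge0//.
  by rewrite ler_weXn2l// up_factor_ge1.
rewrite ler_wiXn2l ?down_factor_ge0 ?down_factor_le1//.
rewrite ltnNge; apply/negP => jk; move: thj; apply/negP; rewrite -leNgt.
by apply: le_trans kL; exact: tau_nondecreasing.
Qed.

(** When no stopping time exceeds the horizon, this makes the potential unbounded. *)
Lemma potential_ge_up k : (tau X h k w <= horizon%:E)%E ->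
  expR (- lam * N) * up_factor lam ^+ k <= potential g M.
Proof.
move=> kth.
have lam4 : lam < 1/4 by move: (l1); lra.
have small := small_increments X h w h0 D lam M g D0 gE osc.
apply: le_trans (potential_ge g M small).
have kU := tau_le_switches X h w h0 X0 cX D lam M g D0 l0 lam4 gE osc k kth.
rewrite -[leLHS]addr0 lerD//.
  by rewrite ler_wpM2l ?expR_ge0// ler_weXn2l// up_factor_ge1.
by rewrite mulr_ge0 ?expR_ge0// exprn_ge0// down_factor_ge0.
Qed.
End path.
End potential.

Section expectation_potential.
Context {R : realType} {d : measure_display} {Omega : measurableType d}.
Variables (P : probability Omega R) (W : R -> Omega -> R).
Hypothesis bm : brownian_motion P W.
Variables (delta lam : R) (Nn : nat).
Hypotheses (delta0 : 0 < delta) (lam01 : 0 < lam <= 1/8) (Nn0 : (0 < Nn)%N).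
Let N : R := Nn%:R.
Let c := Num.sqrt delta.
Let l0 : 0 < lam. Proof. by case/andP: lam01. Qed.
Let l1 : lam <= 1/8. Proof. by case/andP: lam01. Qed.
Let c0 : 0 < c. Proof. by rewrite sqrtr_gt0. Qed.
Let N0 : 0 < N. Proof. by rewrite ltr0n. Qed.

(** The lower bound on [m] makes the truncated variance so close to [1 / m] that
    the deficit, summed over the [N * m] steps, costs at most a factor [expR 1]. *)
Lemma expectation_potential (m : nat) : (0 < m)%N ->
  ((1 + 10 * lam * N) / lam) ^+ 2 <= m%:R ->
  (\int[P]_w (potential lam N (increment W (delta / m%:R) c ^~ w) (Nn * m))%:E
    <= (1 + expR 1)%:E)%E.
Proof.
move=> m0 mB.
have m1 : 0 < m%:R :> R by rewrite ltr0n.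
set D := delta / m%:R.
have D0 : 0 < D by rewrite divr_gt0.
have Dc : D / c ^+ 2 = m%:R^-1.
  by rewrite /c sqr_sqrtr ?ltW// /D; field; rewrite !gt_eqF.
set s := truncated_variance D c lam.
have /andP[s1 s2] := truncated_variance_bounds D c D0 c0 lam l0.
rewrite -/s Dc in s1 s2.
set a := Num.sqrt D / (lam * c).
have a0 : 0 <= a by rewrite divr_ge0 ?sqrtr_ge0 ?mulr_ge0 ?ltW.
have aa : a ^+ 2 = D / (lam * c) ^+ 2 by rewrite /a expr_div_n sqr_sqrtr// ltW.
rewrite -![4 * _ / _]mulrA -![6 * _ / _]mulrA -/a -aa in s1.
set B := 1 + 10 * lam * N in mB.
have lN0 : 0 < lam * N by rewrite mulr_gt0.
have B1 : 1 <= B by rewrite /B; move: lN0; lra.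
have B0 : 0 < B by exact: lt_le_trans B1.
have aB : a <= B^-1.
  rewrite -(@ler_pXn2r _ 2) ?nnegrE ?invr_ge0 ?(ltW B0)//.
  have -> : a ^+ 2 = (lam ^+ 2 * m%:R)^-1.
    rewrite aa exprMn /c sqr_sqrtr ?(ltW delta0)// /D.
    by field; rewrite !gt_eqF.
  rewrite exprVn lef_pV2 ?posrE ?mulr_gt0 ?exprn_gt0//.
  by move: mB; rewrite expr_div_n ler_pdivrMr ?exprn_gt0// mulrC.
have a1 : a <= 1 by rewrite (le_trans aB)// invf_le1.
have alN : lam * N * (10 * a) <= 1.
  rewrite (@le_trans _ _ (lam * N * (10 * B^-1)))//.
    by rewrite ler_wpM2l ?(ltW lN0)// ler_pM2l.
  rewrite mulrA ler_pdivrMr// mul1r /B; move: lN0; lra.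
have s0 : 0 <= s.
  apply: mulr_ge0; first by rewrite invr_ge0 sqr_ge0.
  by apply: Rintegral_ge0 => x _; exact: sqr_ge0.
have sNm : s * (Nn * m)%:R = N * (s * m%:R) by rewrite natrM /N; ring.
have sM1 : s * (Nn * m)%:R <= N.
  by rewrite sNm ler_piMr ?(ltW N0)// -ler_pdivlMr// div1r.
have sM2 : N * (1 - 10 * a) <= s * (Nn * m)%:R.
  rewrite sNm ler_pM2l// -ler_pdivrMr// mulrC.
  apply: le_trans s1; rewrite ler_wpM2l ?invr_ge0 ?(ltW m1)//.
  have : a ^+ 2 <= a by rewrite expr2 ler_piMr.
  lra.
have exp_pow (x : R) : 0 <= 1 + x -> (1 + x) ^+ (Nn * m) <= expR (x * (Nn * m)%:R).
  move=> x1; rewrite mulrC expRM_natl lerXn2r ?nnegrE ?expR_ge0//.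
  exact: expR_ge1Dx.
have s1' : s <= 1.
  by rewrite (le_trans s2)// invf_le1// ler1n.
have E1 : (\int[P]_w (up_lyapunov lam (increment W D c ^~ w) (Nn * m))%:E <=
    (expR (lam * N))%:E)%E.
  apply: le_trans (expectation_lyapunov_increment P W bm D c D0 c0 lam l0
    (1 - lam) (up_factor lam) lam _ _ _ _ _ _ _) _.
  - by move: (l1); lra.
  - by move: (l1); lra.
  - by rewrite (le_trans ler01)// up_factor_ge1.
  - exact: up_factor_switch.
  - by move=> z _; rewrite addr_ge0// mulr_ge0 ?sqr_ge0// ltW.
  - by rewrite addr_ge0// mulr_ge0// ltW.
  rewrite lee_fin (le_trans (exp_pow _ _))//.
    by rewrite addr_ge0// mulr_ge0// ltW.
  by rewrite ler_expR -mulrA ler_pM2l.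
have ls1 : 0 <= 1 + - lam * s.
  have : lam * s <= 1 * 1 by rewrite ler_pM ?(ltW l0)//; move: (l1); lra.
  by rewrite mulNr; lra.
have E2 : (\int[P]_w (down_lyapunov lam (increment W D c ^~ w) (Nn * m))%:E <=
    (expR (1 - lam * N))%:E)%E.
  apply: le_trans (expectation_lyapunov_increment P W bm D c D0 c0 lam l0
    (1 + lam) (down_factor lam) (- lam) _ _ _ _ _ _ _) _.
  - by move: (l0); lra.
  - by move: (l1); lra.
  - exact: down_factor_ge0.
  - exact: down_factor_switch.
  - move=> z zr; apply: le_trans (down_factor_le _ lam01 _ zr).
    exact: down_factor_ge0.
  - exact: ls1.
  rewrite lee_fin (le_trans (exp_pow _ ls1))//.
  rewrite ler_expR.
  have -> : - lam * s * (Nn * m)%:R = - (lam * (s * (Nn * m)%:R)) by ring.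
  have : lam * (N * (1 - 10 * a)) <= lam * (s * (Nn * m)%:R) by rewrite ler_pM2l.
  by move: alN; lra.
have ml r0 cc kap M : measurable_fun setT
    (fun w => lyapunov r0 lam cc kap (increment W D c ^~ w) M).
  by apply: measurable_lyapunov => j _; exact: (measurable_increment P W bm D c D0).
rewrite /potential; under eq_integral do rewrite EFinD !EFinM.
rewrite ge0_integralD//; last 4 first.
- by move=> w _; rewrite -EFinM lee_fin mulr_ge0 ?expR_ge0 ?up_lyapunov_ge0.
- by apply: emeasurable_funM => //; apply/measurable_EFinP; exact: ml.
- by move=> w _; rewrite -EFinM lee_fin mulr_ge0 ?expR_ge0 ?down_lyapunov_ge0.
- by apply: emeasurable_funM => //; apply/measurable_EFinP; exact: ml.
rewrite !ge0_integralZl//; last 4 first.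
- by apply/measurable_EFinP; exact: ml.
- by move=> w _; rewrite lee_fin down_lyapunov_ge0.
- by apply/measurable_EFinP; exact: ml.
- by move=> w _; rewrite lee_fin up_lyapunov_ge0.
rewrite EFinD; apply: leeD.
  apply: (@le_trans _ _ ((expR (- lam * N))%:E * (expR (lam * N))%:E)%E).
    by apply: lee_wpmul2l => //; rewrite lee_fin expR_ge0.
  by rewrite -EFinM -expRD mulNr addNr expR0.
apply: (@le_trans _ _ ((expR (lam * N))%:E * (expR (1 - lam * N))%:E)%E).
  by apply: lee_wpmul2l => //; rewrite lee_fin expR_ge0.
by rewrite -EFinM -expRD addrC subrK.
Qed.

End expectation_potential.

(** * The moment bound *)

Lemma ntheta_nat {R : realType} (T t0 : R) (n : nat) : 0 < T -> (0 < n)%N ->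
  t0 < T -> exists2 Nn : nat, (2 <= Nn)%N & ntheta T n t0 = Nn%:Z.
Proof.
move=> T0 n0 t0T.
have : 0 < Num.ceil ((T - t0) / (2 * T / n%:R)).
  by rewrite ceil_gt0 divr_gt0 ?subr_gt0// divr_gt0 ?mulr_gt0// ltr0n.
rewrite /ntheta; case: (Num.ceil _) => [k|k]// k0.
by exists (2 * k)%N; rewrite ?PoszM//; lia.
Qed.

Lemma grid_oscillation {R : realType} (x : R -> R) (B delta e : R) :
  {within `[0, +oo[, continuous x} -> 0 < delta -> 0 < e ->
  exists m0 : nat, forall m : nat, (m0 <= m)%N ->
    forall s t, 0 <= s <= B -> 0 <= t <= B ->
      `|s - t| <= delta / m%:R -> `|x s - x t| <= e.
Proof.
move=> cx delta0 e0.
have [r r0 rP] := halfline_unif_continuous x cx B e e0.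
exists (Num.truncn (delta / r)).+1 => m m0 s t s0 t0 st.
apply/ltW/rP => //; apply: (le_lt_trans st).
have m1 : 0 < m%:R :> R by rewrite ltr0n (leq_trans _ m0).
rewrite ltr_pdivrMr// mulrC -ltr_pdivrMr//.
have /andP[_ h] := truncn_itv (divr_ge0 (ltW delta0) (ltW r0)).
by apply: (lt_le_trans h); rewrite ler_nat.
Qed.

Theorem proposition6p11 (R : realType) (K : R) (hK : 0 < K) :
  exists C : R, 0 < C /\
    forall (d : measure_display) (Omega : measurableType d)
      (P : probability Omega R) (W : R -> Omega -> R),
    brownian_motion P W ->
    forall T sigma : R, 0 < T -> 0 < sigma ->
    forall (n : nat) (t0 : R), positive_even n -> 0 <= t0 < T ->
    let X := fun t w => sigma * W t w in
    let J := first_even_after X (step sigma T n) (theta T n t0) in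
    (\int[P]_w (`|J w - (ntheta T n t0)%:~R%:E| `^ K)
       <= (C * (ntheta T n t0)%:~R `^ (K / 2))%:E)%E.
Proof.
have K160 : 0 < (16 * K) `^ K by rewrite powR_gt0// mulr_gt0.
have C0 : 0 < (16 * K) `^ K * expR 1 * (1 + expR 1).
  by rewrite !mulr_gt0 ?expR_gt0// addr_gt0 ?expR_gt0.
exists ((16 * K) `^ K * expR 1 * (1 + expR 1)); split => //.
move=> d Omega P W bm T sigma T0 sigma0 n t0 [n0 _] /andP[_ t0T].
lazy zeta; set X := (X in first_even_after X); set J := first_even_after _ _ _.
have [Nn N2 NE] := ntheta_nat T t0 n T0 n0 t0T.
set delta := T / n%:R.
have delta0 : 0 < delta by rewrite divr_gt0// ltr0n.
have c0 : 0 < Num.sqrt delta by rewrite sqrtr_gt0.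
have hE : step sigma T n = sigma * Num.sqrt delta by [].
have h0 : 0 < step sigma T n by rewrite hE mulr_gt0.
rewrite /J /theta NE /=.
have -> : (Nn%:Z)%:~R = Nn%:R :> R by [].
set N : R := Nn%:R.
have N2' : 2 <= N by rewrite /N (ler_nat _ 2).
have N0 : 0 < N by lra.
have q0 : 0 < Num.sqrt N by rewrite sqrtr_gt0.
have -> : N * T / n%:R = N * delta by rewrite mulrA.
set theta := N * delta; set h := step sigma T n in h0 *.
pose lam : R := (8 * Num.sqrt N)^-1.
have lam01 : 0 < lam <= 1/8.
  rewrite invr_gt0 mulr_gt0//= /lam invfM mul1r -[leRHS]mulr1 ler_wpM2l//.
  by rewrite invf_le1// -sqrtr1 ler_sqrt//; lra.
have /andP[l0 l1] := lam01.
pose Kst := (16 * K) `^ K * expR 1 * N `^ (K / 2).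
have Kst0 : 0 < Kst.
  by apply: mulr_gt0; [apply: mulr_gt0 => //; exact: expR_gt0|exact: powR_gt0].
(* The meshes delta / (m0 + i) are fine enough for expectation_potential. *)
have [m0 m00 m0B] : exists2 m0 : nat, (0 < m0)%N &
    ((1 + 10 * lam * N) / lam) ^+ 2 <= m0%:R.
  have /andP[_ hm] := truncn_itv (sqr_ge0 ((1 + 10 * lam * N) / lam)).
  by exists (Num.truncn (((1 + 10 * lam * N) / lam) ^+ 2)).+1 => //; exact: ltW.
have mi0 i : (0 < m0 + i)%N by rewrite addn_gt0 m00.
pose D i : R := delta / (m0 + i)%:R.
pose g i w j := increment W (D i) (Num.sqrt delta) j w.
pose u i w := (Kst * potential lam N (g i w) (Nn * (m0 + i)))%:E.
have D0 i : 0 < D i by rewrite divr_gt0// ltr0n.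
have MD i : (Nn * (m0 + i))%:R * D i = theta.
  rewrite natrM /D -mulrA (mulrCA _ delta) divff ?mulr1//.
  by rewrite pnatr_eq0 -lt0n.
have est0 g' M : 0 <= potential lam N g' M.
  by rewrite /potential; apply: addr_ge0; apply: mulr_ge0;
    rewrite ?expR_ge0 ?up_lyapunov_ge0 ?down_lyapunov_ge0.
have mest i : measurable_fun setT (fun w => potential lam N (g i w) (Nn * (m0 + i))).
  by apply: measurable_funD; apply: measurable_funM => //;
    apply: measurable_lyapunov => j _; exact: (measurable_increment P W bm _ _ (D0 i)).
have -> : ((16 * K) `^ K * expR 1 * (1 + expR 1) * N `^ (K / 2))%:E =
  (Kst * (1 + expR 1))%:E by congr EFin; rewrite /Kst; ring.
apply: (fatou_ae P u).
- by move=> i; apply/measurable_EFinP; apply: measurable_funM => //; exact: mest.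
- by move=> i w; rewrite lee_fin mulr_ge0// ltW.
- by move=> w; exact: poweR_ge0.
- have := bm_start bm; have := bm_continuous bm; apply: filterS2 => w cW W0.
  have X0 : X 0 w = 0 by rewrite /X W0 mulr0.
  have cX : {within `[0, +oo[, continuous (fun t => X t w)}.
    by move=> t; apply: cvgM; [exact: cvg_cst|exact: cW].
  have [i1 osc] := grid_oscillation _ theta delta (lam * h) cX delta0 (mulr_gt0 l0 h0).
  have gE i j : g i w j = (X (j.+1%:R * D i) w - X (j%:R * D i) w) / h.
    by rewrite /g /increment /X /h hE; field; rewrite !gt_eqF.
  have osc' i : (i1 <= i)%N -> forall s t, 0 <= s <= (Nn * (m0 + i))%:R * D i ->
    0 <= t <= (Nn * (m0 + i))%:R * D i -> `|s - t| <= D i ->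
    `|X s w - X t w| <= lam * h.
    move=> i1i; rewrite MD; apply: osc; exact: leq_trans (leq_addl _ _).
  have th0 : 0 <= theta by rewrite mulr_ge0// ltW.
  have [[j [j2 -> jt j2t]]|[-> allt]] := first_even_afterP X h theta w th0.
  + apply: (limn_einf_ge _ _ i1) => i i1i.
    rewrite -EFinB abse_EFin poweR_EFin lee_fin.
    have := potential_ge_factors lam N lam01 X h (D i) _ w (g i w) h0 X0 cX
      (D0 i) (gE i) (osc' i i1i) (j - 2) j.
    rewrite MD => /(_ j2t jt) est.
    have dev := le_trans (deviation_le N lam j N2' j2 erefl) est.
    set z := `|j%:R - N| / Num.sqrt N in dev.
    have z0 : 0 <= z by rewrite divr_ge0 ?sqrtr_ge0.
    have -> : `|j%:R - N| = z * Num.sqrt N by rewrite divfK// gt_eqF.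
    rewrite (powRM _ z0 (ltW q0)).
    have -> : Num.sqrt N `^ K = N `^ (K / 2).
      by rewrite -powR12_sqrt ?(ltW N0)// -powRrM mulrC.
    have -> : Kst * potential lam N (g i w) (Nn * (m0 + i)) =
      (16 * K) `^ K * (expR 1 * potential lam N (g i w) (Nn * (m0 + i))) * N `^ (K / 2).
      by rewrite /Kst; ring.
    rewrite ler_wpM2r ?powR_ge0// (le_trans (powR_le_expR K z hK z0))//.
    rewrite ler_wpM2l ?powR_ge0//.
    have -> : z / 16 = 1 + (z / 16 - 1) by ring.
    by rewrite expRD ler_wpM2l ?expR_ge0.
  (* Here J is infinite: the number of switches exceeds every k, and the powers
       of the up factor diverge. *)
  + suff -> : limn_einf (u ^~ w) = +oo%E by exact: leey.
    apply/eqyP => A A0; apply: (limn_einf_ge _ _ i1) => i i1i; rewrite lee_fin.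
    pose a := lam - 4 * lam ^+ 2.
    have a0 : 0 < a.
      have : lam * lam <= lam * (1 / 8) by rewrite ler_wpM2l ?(ltW l0).
      by rewrite /a expr2; move: l0; lra.
    pose y := A / Kst * expR (lam * N).
    have y0 : 0 <= y by rewrite mulr_ge0 ?expR_ge0 ?divr_ge0 ?ltW.
    pose k := (Num.truncn (y / a)).+1.
    have := potential_ge_up lam N lam01 X h (D i) _ w (g i w) h0 X0 cX
      (D0 i) (gE i) (osc' i i1i) k.
    rewrite MD => /(_ (allt k)) est.
    rewrite -ler_pdivrMl// mulrC (le_trans _ est)//.
    have -> : A / Kst = expR (- lam * N) * y.
      by rewrite /y mulrCA -expRD mulNr addNr expR0 mulr1.
    rewrite ler_wpM2l ?expR_ge0//.
    apply: (@le_trans _ _ (expR a ^+ k)); last first.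
      rewrite lerXn2r ?nnegrE ?expR_ge0//.
        by rewrite (le_trans ler01)// up_factor_ge1.
      exact: expR_le_up_factor.
    rewrite -expRM_natl (le_trans _ (expR_ge1Dx _))//.
    have /andP[_ hk] := truncn_itv (divr_ge0 y0 (ltW a0)).
    move: hk; rewrite ltr_pdivrMr// -/k => hk.
    by rewrite (le_trans (ltW hk))// lerDr.
- move=> i; rewrite /u; under eq_integral do rewrite EFinM.
  rewrite ge0_integralZl//; last 3 first.
  + by apply/measurable_EFinP; exact: mest.
  + by move=> w _; rewrite lee_fin.
  + by rewrite lee_fin ltW.
  rewrite [leRHS]EFinM; apply: lee_wpmul2l; first by rewrite lee_fin ltW.
  apply: expectation_potential => //; first by rewrite (leq_trans _ N2).
  by apply: (le_trans m0B); rewrite ler_nat leq_addr.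
Qed.
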